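(* Let $\lambda_1,\lambda_2,\lambda_3\in\mathbb{C}$ be such that $\sum_{i\in I}\lambda_i\notin\frac12\mathbb{Z}_{\ge0}$ for every nonempty $I\subseteq\{1,2,3\}$. Let $\lambda_{12},\lambda_{23},\lambda_{123}$ be such that $\lambda_1+\lambda_2-\lambda_{12}$, $\lambda_2+\lambda_3-\lambda_{23}$, $\lambda_{12}+\lambda_3-\lambda_{123}$, $\lambda_1+\lambda_{23}-\lambda_{123}\in\mathbb{Z}_{\ge0}$. Then the $q6j$-symbols, i.e. the coefficients in the expansion $$e^{\lambda_{12},\lambda_{123}}_a=\sum_{\lambda_{23}}\begin{Bmatrix}\lambda_1&\lambda_2&\lambda_{12}\\ \lambda_3&\lambda_{123}&\lambda_{23}\end{Bmatrix}_qe^{\lambda_{23},\lambda_{123}}_a,$$ are given by $$\begin{Bmatrix}\lambda_1&\lambda_2&\lambda_{12}\\ \lambda_3&\lambda_{123}&\lambda_{23}\end{Bmatrix}_q=\frac{\Delta(\lambda_1,\lambda_{23},\lambda_{123})}{\prod\limits_{j=0}^{\lambda_1+\lambda_{23}-\lambda_{123}-1}[2\lambda_{23}-j]_q}\cdot\frac{\Delta(\lambda_2,\lambda_3,\lambda_{23})}{\prod\limits_{j=0}^{\lambda_2+\lambda_3-\lambda_{23}-1}[2\lambda_3-j]_q}\cdot\frac{\Delta(\lambda_{12},\lambda_3,\lambda_{123})}{\prod\limits_{j=0}^{\lambda_{12}+\lambda_3-\lambda_{123}-1}[2\lambda_{12}-j]_q}\cdot\frac{\Delta(\lambda_1,\lambda_2,\lambda_{12})}{\prod\limits_{j=0}^{\lambda_1+\lambda_2-\lambda_{12}-1}[2\lambda_1-j]_q}$$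 $$\times\frac1{\prod\limits_{j=0}^{\lambda_1+\lambda_2-\lambda_{12}-1}[2\lambda_2-j]_q}\sum_{z=0}^{\lambda_1+\lambda_2-\lambda_{12}}(-1)^z\prod_{j=0}^{\lambda_1+\lambda_2+\lambda_3-\lambda_{123}-z-1}[2\lambda_{123}+2+j]_q$$ $$\times\frac{\prod\limits_{j=0}^{z-1}[\lambda_{123}+\lambda_1-\lambda_{23}-j]_q\prod\limits_{j=0}^{z-1}[\lambda_{123}-\lambda_{12}+\lambda_3-j]_q\prod\limits_{j=0}^{\lambda_1+\lambda_2-\lambda_{12}-z-1}[\lambda_2+\lambda_{23}-\lambda_3-j]_q}{[z]_q!\,[\lambda_1+\lambda_2-\lambda_{12}-z]_q!\,[\lambda_2+\lambda_3-\lambda_{23}-z]_q!\,[\lambda_{12}+\lambda_{23}-\lambda_2-\lambda_{123}+z]_q!}.$$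
   Context: Notation: $q=e^{h/2}$ with $h\in\mathbb{C}$, $q^x:=e^{hx/2}$, $[x]_q=\frac{q^x-q^{-x}}{q-q^{-1}}$, $[n]_q!=\prod_{s=1}^n[s]_q$, $[0]_q!=1$, $(-1)^{J/2}:=e^{i\pi J/2}$. The parameter $q$ is generic: $[x]_q\neq0$ for every nonzero $x\in\mathbb{Z}+2\mathbb{Z}\lambda_1+2\mathbb{Z}\lambda_2+2\mathbb{Z}\lambda_3$. Terms with $[n]_q!$, $n$ a negative integer, in the denominator are omitted; empty products (such as $\prod_{j=0}^{-1}$) equal $1$. $U_q(\mathfrak{sl}_2)$ has generators $E,F,K^{\pm1}$ with $KE=q^2EK$, $KF=q^{-2}FK$, $[E,F]=\frac{K-K^{-1}}{q-q^{-1}}$, coproduct $\Delta E=E\otimes K+1\otimes E$, $\Delta F=F\otimes1+K^{-1}\otimes F$, $\Delta K=K\otimes K$. For $\mu\notin\frac12\mathbb{Z}_{\ge0}$ the Verma module $M_\mu$ has basis $e^\mu_a$, $a\in\mu-\mathbb{Z}_{\ge0}$, with $Ke^\mu_a=q^{2a}e^\mu_a$, $Ee^\mu_a=[\mu-a]_qe^\mu_{a+1}$, $Fe^\mu_a=[\mu+a]_qe^\mu_{a-1}$. For $\mu=\mu_1+\mu_2-J$, $J\in\mathbb{Z}_{\ge0}$, the $q3j$-symbols $$\begin{bmatrix}\mu_1&\mu_2&\mu\\ a_1&a_2&a\end{bmatrix}^\psi_q=(-1)^{\frac J2+\mu_1-a_1}q^{(\mu_2^2-a_2^2)-(\mu^2-a^2)-(\mu_1-a_1)}\frac{[\mu-a]_q!\,\Delta(\mu_1,\mu_2,\mu)}{\prod_{j=1}^{\mu-a}[\mu+a+j]_q}\sum_{z+w=\mu-a}(-1)^zq^{z(\mu+a+1)}\frac{\prod_{j=1}^z[\mu_1+a_1+j]_q\prod_{j=1}^w[\mu_2+a_2+j]_q}{[z]_q![w]_q![\mu_1-a_1-z]_q![\mu_2-a_2-w]_q!}$$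 ($z,w\in\mathbb{Z}_{\ge0}$, $a=a_1+a_2$; zero if $a\ne a_1+a_2$) are the matrix coefficients of a module embedding $M_\mu\hookrightarrow M_{\mu_1}\otimes M_{\mu_2}$, $e^\mu_a\mapsto\sum_{a_1+a_2=a}[\cdots]^\psi_qe^{\mu_1}_{a_1}\otimes e^{\mu_2}_{a_2}$. Here $$\Delta(\mu_1,\mu_2,\mu)=\Big([\mu_1+\mu_2-\mu]_q!\prod_{j=0}^{\mu_1+\mu_2-\mu-1}\frac{[2\mu_1-j]_q[2\mu_2-j]_q}{[2\mu+2+j]_q}\Big)^{1/2}$$ with a square root fixed once and for all for each triple. Iterating these embeddings in two ways gives vectors in $M_{\lambda_1}\otimes M_{\lambda_2}\otimes M_{\lambda_3}$: $$e^{\lambda_{12},\lambda_{123}}_a=\sum_{a_1+a_2+a_3=a}\begin{bmatrix}\lambda_{12}&\lambda_3&\lambda_{123}\\ a_1+a_2&a_3&a\end{bmatrix}^\psi_q\begin{bmatrix}\lambda_1&\lambda_2&\lambda_{12}\\ a_1&a_2&a_1+a_2\end{bmatrix}^\psi_qe^{\lambda_1}_{a_1}\otimes e^{\lambda_2}_{a_2}\otimes e^{\lambda_3}_{a_3},$$ $$e^{\lambda_{23},\lambda_{123}}_a=\sum_{a_1+a_2+a_3=a}\begin{bmatrix}\lambda_1&\lambda_{23}&\lambda_{123}\\ a_1&a_2+a_3&a\end{bmatrix}^\psi_q\begin{bmatrix}\lambda_2&\lambda_3&\lambda_{23}\\ a_2&a_3&a_2+a_3\end{bmatrix}^\psi_qe^{\lambda_1}_{a_1}\otimes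 e^{\lambda_2}_{a_2}\otimes e^{\lambda_3}_{a_3},$$ with $3j$-symbols read as $0$ when a weight $a_I$ is not in $\lambda_I-\mathbb{Z}_{\ge0}$. In the expansion defining the $q6j$-symbols, $\lambda_{23}$ runs over the finite set with $\lambda_2+\lambda_3-\lambda_{23}\in\mathbb{Z}_{\ge0}$ and $\lambda_1+\lambda_{23}-\lambda_{123}\in\mathbb{Z}_{\ge0}$, and the coefficients do not depend on $a\in\lambda_{123}-\mathbb{Z}_{\ge0}$. *)

(* Defs.v *)
From HB Require Import structures.
From mathcomp Require Import all_boot all_order all_algebra.
From mathcomp Require Import all_classical all_reals all_analysis.
From mathcomp Require Import complex freeg.

Set Implicit Arguments.
Unset Strict Implicit.
Unset Printing Implicit Defensive.

Import Order.TTheory GRing.Theory Num.Theory.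
Local Open Scope ring_scope.

Section IntegerDifferences.
Variable R : realType.
Implicit Types (x mu : R[i]) (n : nat).

(* [natC x] is the natural number x stands for when [isnat x] holds; otherwise
   its value is irrelevant. *)
Definition natC x : nat := Num.truncn (complex.Re x).

Definition isnat x : bool := x == (natC x)%:R.

Lemma natCK n : natC n%:R = n.
Proof. by rewrite /natC raddfMn /= natrK. Qed.

Lemma isnat_nat n : isnat n%:R.
Proof. by rewrite /isnat natCK. Qed.

(* The set of weights mu - Z_{>=0} of the Verma module M_mu. *)
Definition weight mu := {a : R[i] | isnat (mu - a)}.

Lemma wt_subproof mu n : isnat (mu - (mu - n%:R)).
Proof. by rewrite subKr isnat_nat. Qed.

Definition wt mu n : weight mu := Sub (mu - n%:R) (wt_subproof mu n).

End IntegerDifferences.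

(* M_l1 (x) M_l2 (x) M_l3, as the free module on its weight basis: [<< w >>],
   w = (a1, a2, a3), is e^l1_a1 (x) e^l2_a2 (x) e^l3_a3. *)
Notation verma3 R l1 l2 l3 :=
  {freeg (@weight R l1 * @weight R l2 * @weight R l3)%type / R[i]}.

Section QNumbers.
Variable R : realType.
Implicit Types (h x mu : R[i]) (n : nat).

Definition expC x : R[i] :=
  (expR (complex.Re x))%:C%C *
  (cos (complex.Im x) +i* sin (complex.Im x))%C.

(* (-1)^x = e^{i pi x} *)
Definition expN1 x : R[i] := expC ('i * (pi : R)%:C%C * x).

(* q^x for q = e^{h/2} *)
Definition qpow h x : R[i] := expC (h * x / 2).

Definition qnum h x : R[i] :=
  (qpow h x - qpow h (- x)) / (qpow h 1 - qpow h (- 1)).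

Definition qfact h n : R[i] := \prod_(1 <= s < n.+1) qnum h s%:R.

(* 1 / [x]_q!, read as 0 when x is a negative integer: the terms with such a
   factorial in the denominator are omitted. *)
Definition qfactV h x : R[i] := if isnat x then (qfact h (natC x))^-1 else 0.

(* At q = -1, 1 the convention 0^-1 = 0 gives [1]_q = 0, so that genericity
   excludes these values. *)
Definition generic h (l1 l2 l3 : R[i]) : Prop :=
  forall n k1 k2 k3 : int,
    let x := n%:~R + 2 * k1%:~R * l1 + 2 * k2%:~R * l2 + 2 * k3%:~R * l3 in
    x != 0 -> qnum h x != 0.

Definition no_half_nat (l1 l2 l3 : R[i]) : Prop :=
  forall I : {set 'I_3}, I != finset.set0 ->
  forall n, \sum_(i in I) [:: l1; l2; l3]`_i != n%:R / 2.

(* [D] is a choice of the square roots Delta(mu1, mu2, mu), one for each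
   triple. *)
Definition is_Delta h (D : R[i] -> R[i] -> R[i] -> R[i]) : Prop :=
  forall mu1 mu2 mu, isnat (mu1 + mu2 - mu) ->
  let J := natC (mu1 + mu2 - mu) in
  D mu1 mu2 mu ^+ 2 =
  qfact h J *
  \prod_(j < J) (qnum h (2 * mu1 - j%:R) * qnum h (2 * mu2 - j%:R) /
                 qnum h (2 * mu + 2 + j%:R)).

Definition q3j h (D : R[i] -> R[i] -> R[i] -> R[i])
    (mu1 mu2 mu a1 a2 a : R[i]) : R[i] :=
  if [&& a == a1 + a2, isnat (mu1 - a1), isnat (mu2 - a2), isnat (mu - a)
       & isnat (mu1 + mu2 - mu)] then
    let J := mu1 + mu2 - mu in
    let n := natC (mu - a) in
    expN1 (J / 2 + mu1 - a1) *
    qpow h ((mu2 ^+ 2 - a2 ^+ 2) - (mu ^+ 2 - a ^+ 2) - (mu1 - a1)) *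
    (qfact h n * D mu1 mu2 mu / \prod_(1 <= j < n.+1) qnum h (mu + a + j%:R)) *
    \sum_(z < n.+1) let w := (n - z)%N in
      (-1) ^+ z * qpow h (z%:R * (mu + a + 1)) *
      (\prod_(1 <= j < z.+1) qnum h (mu1 + a1 + j%:R) *
       \prod_(1 <= j < w.+1) qnum h (mu2 + a2 + j%:R)) *
      (qfact h z)^-1 * (qfact h w)^-1 *
      qfactV h (mu1 - a1 - z%:R) * qfactV h (mu2 - a2 - w%:R)
  else 0.

End QNumbers.

Section Coupling.
Variables (R : realType) (h : R[i]) (D : R[i] -> R[i] -> R[i] -> R[i]).
Variables l1 l2 l3 : R[i].

(* \sum_{a1 + a2 + a3 = a} c a1 a2 a3 e_a1 (x) e_a2 (x) e_a3, the weights being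
   ai = li - mi with mi natural numbers. *)
Definition weight_sum (c : R[i] -> R[i] -> R[i] -> R[i]) (a : R[i]) :
    verma3 R l1 l2 l3 :=
  let d := natC (l1 + l2 + l3 - a) in
  \sum_(m : 'I_d.+1 * 'I_d.+1 * 'I_d.+1 | (m.1.1 + m.1.2 + m.2 == d)%N)
    let w1 := wt l1 m.1.1 in let w2 := wt l2 m.1.2 in let w3 := wt l3 m.2 in
    << c (val w1) (val w2) (val w3) *g (w1, w2, w3) >>.

Definition vec12 (l12 l123 a : R[i]) : verma3 R l1 l2 l3 :=
  weight_sum (fun a1 a2 a3 =>
    q3j h D l12 l3 l123 (a1 + a2) a3 a *
    q3j h D l1 l2 l12 a1 a2 (a1 + a2)) a.

Definition vec23 (l23 l123 a : R[i]) : verma3 R l1 l2 l3 :=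
  weight_sum (fun a1 a2 a3 =>
    q3j h D l1 l23 l123 a1 (a2 + a3) a *
    q3j h D l2 l3 l23 a2 a3 (a2 + a3)) a.

(* [c l23] is the coefficient of e^{l23,l123}_a.  The admissible l23 are the
   l2 + l3 - k, where l1 + l23 - l123 = (l1 + l2 + l3 - l123) - k forces
   0 <= k <= l1 + l2 + l3 - l123. *)
Definition q6j_expansion (l12 l123 a : R[i]) (c : R[i] -> R[i]) : Prop :=
  vec12 l12 l123 a =
  \sum_(k < (natC (l1 + l2 + l3 - l123)).+1)
    c (l2 + l3 - k%:R) *: vec23 (l2 + l3 - k%:R) l123 a.

Definition q6j_formula (l12 l123 l23 : R[i]) : R[i] :=
  let J12 := natC (l1 + l2 - l12) in
  D l1 l23 l123 /
    \prod_(j < natC (l1 + l23 - l123)) qnum h (2 * l23 - j%:R) *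
  (D l2 l3 l23 /
    \prod_(j < natC (l2 + l3 - l23)) qnum h (2 * l3 - j%:R)) *
  (D l12 l3 l123 /
    \prod_(j < natC (l12 + l3 - l123)) qnum h (2 * l12 - j%:R)) *
  (D l1 l2 l12 / \prod_(j < J12) qnum h (2 * l1 - j%:R)) *
  (\prod_(j < J12) qnum h (2 * l2 - j%:R))^-1 *
  \sum_(z < J12.+1)
    (-1) ^+ z *
    \prod_(j < natC (l1 + l2 + l3 - l123 - z%:R))
      qnum h (2 * l123 + 2 + j%:R) *
    (\prod_(j < z) qnum h (l123 + l1 - l23 - j%:R) *
     \prod_(j < z) qnum h (l123 - l12 + l3 - j%:R) *
     \prod_(j < natC (l1 + l2 - l12 - z%:R)) qnum h (l2 + l23 - l3 - j%:R)) *
    ((qfact h z)^-1 *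
     qfactV h (l1 + l2 - l12 - z%:R) *
     qfactV h (l2 + l3 - l23 - z%:R) *
     qfactV h (l12 + l23 - l2 - l123 + z%:R)).

End Coupling.

(* Main.v *)
Require Import Defs.
From mathcomp Require Import all_boot all_order all_algebra.
From mathcomp Require Import all_classical all_reals all_analysis.
From mathcomp Require Import complex freeg ring zify.

Set Implicit Arguments.
Unset Strict Implicit.
Unset Printing Implicit Defensive.
Import Order.TTheory GRing.Theory Num.Theory.
Local Open Scope ring_scope.

(* In the basis F^m v of a Verma module, F acts by a shift and the 3j-symbols
   become, up to normalization, the coordinates of F^n u, where u is an explicit
   singular vector of a tensor product of two Verma modules.  Both couplings of
   three Verma modules are then families of vectors, at the levels N, N+1, ...,
   each of which is F applied to the preceding one, so it suffices to compare
   them at level N = l1 + l2 + l3 - l123, where E kills them.  There the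
   coefficient of the coupling through l23 = l2 + l3 - k is isolated by a linear
   functional on level k of the last two factors that annihilates the image of
   F.  The q-Vandermonde identity evaluates it as a terminating balanced 4phi3
   sum, and Sears' transformation turns that sum into the one of the theorem. *)

(** One functional per level suffices because, on two Verma modules, F maps level k - 1, of
    dimension k, injectively into level k, of dimension k + 1: up to a scalar only [sing_form] kills
    the image. Its value on the singular vector of level k is a q-Vandermonde sum, which genericity
    keeps away from 0. On the slice m1 = N - k of level N, the coupling with parameter j vanishes
    for j > k and lies in the image of F for j < k, so the system for the coefficients is diagonal
    and no matrix has to be inverted. The square roots Delta are mere normalizations of the
    embeddings: the expansion of [W12] in the [W23] involves none, and they return only with the
    weight basis. Weights live in an abstract ring with an exponential map to a field, since the
    argument uses only p (x + y) = p x * p y and the nonvanishing of certain q-numbers. *)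

Definition qnumber (V : comNzRingType) (F : fieldType) (p : V -> F) x : F :=
  (p x - p (- x)) / (p 1 - p (- 1)).

(** An abstract q^x. By the convention 0^-1 = 0, the last field at n = 0 forces q and q^-1 to
    differ; over all n it says that q is not a root of unity. *)
Record qexponential (V : comNzRingType) (F : fieldType) := QExponential {
  qexp :> V -> F;
  qexpD : {morph qexp : x y / x + y >-> x * y};
  qexp0 : qexp 0 = 1;
  qnumberS_neq0 : forall n, qnumber qexp n.+1%:R != 0 }.

(** * q-numbers, q-factorials and their shifted products *)

Section QCalculus.
Variables (V : comNzRingType) (F : fieldType) (p : qexponential V F).
Implicit Types (x y u v t : V) (m n : nat).

Definition qn x : F := qnumber p x.
Definition qfac n : F := \prod_(1 <= s < n.+1) qn s%:R.
Definition qfall x n : F := \prod_(j < n) qn (x - j%:R).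
Definition qrise x n : F := \prod_(j < n) qn (x + j%:R).
Local Notation fa := qfac.
Local Notation ff := qfall.
Local Notation rf := qrise.

Definition qbinom n r : F := fa n / (fa r * fa (n - r)).

Let pD := qexpD p.
Let p0 := qexp0 p.
Let qnS_neq0 := qnumberS_neq0 p.

Lemma qexpV x : p (- x) = (p x)^-1.
Proof.
apply: (can_inj (@invrK F)); rewrite invrK; apply/esym/divr1_eq.
by rewrite invrK -pD subrr.
Qed.

Lemma qexp_neq0 x : p x != 0.
Proof.
have := pD x (- x); rewrite subrr p0 => /esym/eqP.
by apply: contraTneq => ->; rewrite mul0r eq_sym oner_eq0.
Qed.

Lemma qexp1_sub_neq0 : p 1 - p (- 1) != 0.
Proof. by have := qnS_neq0 0; rewrite /qnumber mulf_eq0 negb_or invr_eq0 => /andP[]. Qed.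

Lemma qn0 : qn 0 = 0. Proof. by rewrite /qn /qnumber oppr0 subrr mul0r. Qed.

Lemma qnN x : qn (- x) = - qn x.
Proof. by rewrite /qn /qnumber opprK -mulNr opprB. Qed.

Lemma qnD x y : qn (x + y) = p y * qn x + p (- x) * qn y.
Proof.
rewrite /qn /qnumber !opprD !pD !mulrA -mulrDl; congr (_ / _); ring.
Qed.

(** The three-term relation of q-numbers; it does for q-Saalschuetz what [qnD] does for
    q-Vandermonde. *)
Lemma qnDM u v t : qn (u + t) * qn (v + t) = qn u * qn v + qn t * qn (u + v + t).
Proof.
have k0 := qexp1_sub_neq0.
rewrite /qn /qnumber !opprD !pD !qexpV; move: k0; rewrite !qexpV => k0.
have := qexp_neq0 u; have := qexp_neq0 v; have := qexp_neq0 t.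
set a := p u; set b := p v; set c := p t; move: k0; set k := p 1 - _ => k0 ? ? ?.
by field; apply/and4P.
Qed.

Lemma fa0 : fa 0 = 1. Proof. by rewrite /qfac big_nil. Qed.
Lemma faS n : fa n.+1 = qn n.+1%:R * fa n.
Proof. by rewrite /qfac big_nat_recr //= mulrC. Qed.
Lemma fa_neq0 n : fa n != 0.
Proof. by elim: n => [|n IH]; rewrite ?fa0 ?oner_eq0 // faS mulf_neq0. Qed.
Lemma ff0 x : ff x 0 = 1. Proof. by rewrite /qfall big_ord0. Qed.
Lemma ffS x n : ff x n.+1 = ff x n * qn (x - n%:R).
Proof. by rewrite /qfall big_ord_recr. Qed.
Lemma ffSl x n : ff x n.+1 = qn x * ff (x - 1) n.
Proof.
rewrite /qfall big_ord_recl subr0; congr (_ * _); apply: eq_bigr => i _.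
congr qn; rewrite /= /bump /=; ring.
Qed.
Lemma rf0 x : rf x 0 = 1. Proof. by rewrite /qrise big_ord0. Qed.
Lemma rfS x n : rf x n.+1 = rf x n * qn (x + n%:R).
Proof. by rewrite /qrise big_ord_recr. Qed.
Lemma rfD x m n : rf x (m + n) = rf x m * rf (x + m%:R) n.
Proof.
rewrite /qrise big_split_ord /=; congr (_ * _); apply: eq_bigr => i _.
by rewrite natrD addrA.
Qed.
Lemma ffD x m n : ff x (m + n) = ff x m * ff (x - m%:R) n.
Proof.
rewrite /qfall big_split_ord /=; congr (_ * _); apply: eq_bigr => i _.
by rewrite natrD opprD addrA.
Qed.
Lemma ffE x n : ff x n = rf (x - n%:R + 1) n.
Proof.
rewrite /qfall /qrise (reindex_inj rev_ord_inj) /=; apply: eq_bigr => i _; congr qn.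
by rewrite /= natrB //; ring.
Qed.
Lemma ffN x n : ff (- x) n = (- 1) ^+ n * rf x n.
Proof.
elim: n => [|n IH]; first by rewrite ff0 rf0 mul1r.
rewrite ffS rfS IH -opprD qnN exprS; ring.
Qed.
Lemma ff_small n m : (n < m)%N -> ff n%:R m = 0.
Proof. by move=> h; rewrite /qfall (bigD1 (Ordinal h)) //= subrr qn0 mul0r. Qed.
Lemma ff_nat m n : ff (m + n)%:R n * fa m = fa (m + n).
Proof.
elim: n => [|n IH]; first by rewrite ff0 mul1r addn0.
rewrite addnS ffSl faS -IH mulrA; congr (qn _ * ff _ _ * _).
by rewrite -[X in X - 1]natr1 addrK.
Qed.

End QCalculus.

(** * The q-Vandermonde and q-Saalschuetz summations *)

Section Summation.
Variables (V : comNzRingType) (F : fieldType) (p : qexponential V F).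
Local Notation "[[ x ]]" := (qn p x) (at level 0).
Local Notation ff := (qfall p).
Local Notation rf := (qrise p).
Local Notation qb := (qbinom p).
Implicit Types (x y u v t : V) (m n : nat).

Lemma qb0 n : qb n 0 = 1.
Proof. by rewrite /qbinom fa0 mul1r subn0 divff ?fa_neq0. Qed.

Lemma qn_nat_neq0 n : (0 < n)%N -> [[ n%:R ]] != 0.
Proof. by case: n => // n _; exact: qnumberS_neq0. Qed.

Lemma qbl s r : (r <= s)%N -> qb s r = qb s.+1 r * ([[ (s.+1 - r)%:R ]] / [[ s.+1%:R ]]).
Proof.
move=> rs; rewrite /qbinom (subSn rs) !faS.
have := fa_neq0 p s; have := fa_neq0 p r; have := fa_neq0 p (s - r).
have := @qn_nat_neq0 s.+1 isT; have := @qn_nat_neq0 (s - r).+1 isT.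
by move=> *; field; repeat (apply/andP; split).
Qed.

Lemma qbr s r : (r <= s)%N -> qb s r = qb s.+1 r.+1 * ([[ r.+1%:R ]] / [[ s.+1%:R ]]).
Proof.
move=> rs; rewrite /qbinom subSS !faS.
have := fa_neq0 p s; have := fa_neq0 p r; have := fa_neq0 p (s - r).
have := @qn_nat_neq0 s.+1 isT; have := @qn_nat_neq0 r.+1 isT.
by move=> *; field; repeat (apply/andP; split).
Qed.

(* A sum over a binomial row is obtained from the previous row once each term
   t s r splits as in Pascal's rule. *)
Lemma qb_sum_step s (T U W : nat -> F) :
  (forall r, (r <= s)%N -> [[ (s.+1 - r)%:R ]] * T r + [[ r%:R ]] * U r = [[ s.+1%:R ]] * W r)
    ->
  [[ s.+1%:R ]] * U s.+1 = [[ s.+1%:R ]] * W s.+1 ->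
  \sum_(r < s.+1) qb s r * (T r + U r.+1) = \sum_(r < s.+2) qb s.+1 r * W r.
Proof.
move=> H Hs; have q0 := @qn_nat_neq0 s.+1 isT.
under eq_bigr => r _ do rewrite mulrDr.
rewrite big_split /=.
have -> : \sum_(r < s.+1) qb s r * T r =
   \sum_(r < s.+2) qb s.+1 r * ([[ (s.+1 - r)%:R ]] / [[ s.+1%:R ]] * T r).
  rewrite [RHS]big_ord_recr /= subnn qn0 !mul0r mulr0 addr0.
  by apply: eq_bigr => r _; rewrite qbl ?mulrA //; exact: (ltn_ord r).
have -> : \sum_(r < s.+1) qb s r * U r.+1 =
   \sum_(r < s.+2) qb s.+1 r * ([[ r%:R ]] / [[ s.+1%:R ]] * U r).
  rewrite [RHS]big_ord_recl /= qn0 !mul0r mulr0 add0r.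
  by apply: eq_bigr => r _; rewrite qbr ?mulrA //; exact: (ltn_ord r).
rewrite -big_split /=; apply: eq_bigr => r _; rewrite -mulrDr; congr (_ * _).
apply: (mulfI q0); have := ltn_ord r; rewrite ltnS leq_eqVlt => /orP[/eqP ->|].
  by rewrite subnn qn0 !mul0r add0r -Hs mulfV // mul1r.
rewrite ltnS => /H <-; field; exact: q0.
Qed.

(** Induction on k: [qnD] splits the new factor [x + y + k] into a part that lengthens [rf x] and a
    part that lengthens [rf y], the two terms of [qb_sum_step]. *)
Lemma q_vandermonde x y k :
  \sum_(m < k.+1) qb k m * (p ((k - m)%:R * y - m%:R * x) * rf y m * rf x (k - m)) = rf (x +
    y) k.
Proof.
elim: k => [|k IH].
  rewrite big_ord1 qb0 subnn !mul0r subr0 qexp0 !rf0; ring.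
rewrite rfS -IH mulr_suml; apply/esym/(etrans _ (qb_sum_step
  (T := fun m => p ((k - m)%:R * y - m%:R * x) * p (y + m%:R) * rf y m * rf x (k.+1 - m))
  (U := fun m => p ((k.+1 - m)%:R * y - m.-1%:R * x) * p (- (x + (k.+1 - m)%:R)) * rf y m * rf
    x (k.+1 - m))
  (W := fun m => p ((k.+1 - m)%:R * y - m%:R * x) * rf y m * rf x (k.+1 - m)) _ _)).
- apply: eq_bigr => m _; rewrite -(mulrA (qb k m)); congr (_ * _).
  have mk : (m <= k)%N by rewrite -ltnS.
  rewrite /= subSS (subSn mk) !rfS.
  have -> : x + y + k%:R = (x + (k - m)%:R) + (y + m%:R) by rewrite natrB //; ring.
  rewrite (qnD _ (x + _)); ring.
- move=> r rk.
  have -> : p ((k.+1 - r)%:R * y - r%:R * x) = p ((k - r)%:R * y - r%:R * x) * p y.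
    by rewrite -qexpD !natrB ?(leqW rk) //; congr qexp; ring.
  have -> : [[ k.+1%:R ]] = p r%:R * [[ (k.+1 - r)%:R ]] + p (- (k.+1 - r)%:R) * [[ r%:R ]].
    by rewrite -qnD -natrD subnK // leqW.
  case: r rk => [|r] rk; first by rewrite !mulr0n qn0 !mul0r !addr0 qexp0; ring.
  rewrite subSS.
  have -> : p ((k - r)%:R * y - r.+1.-1%:R * x) * p (- (x + (k - r)%:R)) =
      p ((k - r.+1)%:R * y - r.+1%:R * x) * p y * p (- (k - r)%:R).
    rewrite -!qexpD; congr qexp; rewrite (natrB _ rk) (natrB _ (ltnW rk)) /=; ring.
  rewrite !qexpD; ring.
- rewrite !subnn /=; congr (_ * _).
  have <- : p (0%:R * y - k%:R * x) * p (- (x + 0%:R)) = p (0%:R * y - k.+1%:R * x).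
    by rewrite -qexpD; congr qexp; ring.
  ring.
Qed.

(** Free of denominators, hence valid for all parameters. In the induction, [qnDM] with t = M + 1 +
    s + r splits the product of the two new factors on the right: one part lengthens [ff b] and
    [ff c], the other [rf (b + c + M + 1)]. *)
Lemma q_saalschutz b c M s :
  \sum_(r < s.+1) qb s r * (ff b r * ff c r * rf (b + c + M + 1) (s - r) * ff (M + s%:R) (s -
    r))
  = rf (b + M + 1) s * rf (c + M + 1) s.
Proof.
elim: s => [|s IH].
  by rewrite big_ord1 qb0 subnn !ff0 !rf0; ring.
rewrite !rfS mulrACA -IH mulr_suml; apply/esym/(etrans _ (qb_sum_step
  (T := fun r => [[ M + 1 + s%:R + r%:R ]] * (ff b r * ff c r * rf (b + c + M + 1) (s.+1 - r))
    * ff (M + s%:R) (s - r))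
  (U := fun r => ff b r * ff c r * rf (b + c + M + 1) (s.+1 - r) * ff (M + s%:R) (s.+1 - r))
  (W := fun r => ff b r * ff c r * rf (b + c + M + 1) (s.+1 - r) * ff (M + s.+1%:R) (s.+1 -
    r)) _ _)).
- apply: eq_bigr => r _; rewrite -(mulrA (qb s r)); congr (_ * _).
  have rs : (r <= s)%N by rewrite -ltnS.
  rewrite /= ?subSS (subSn rs) !ffS rfS.
  have -> : b + M + 1 + s%:R = (b - r%:R) + (M + 1 + s%:R + r%:R) by ring.
  have -> : c + M + 1 + s%:R = (c - r%:R) + (M + 1 + s%:R + r%:R) by ring.
  rewrite qnDM.
  have -> : b - r%:R + (c - r%:R) + (M + 1 + s%:R + r%:R) = b + c + M + 1 + (s - r)%:R.
    by rewrite natrB //; ring.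
  ring.
- move=> r rs; rewrite (subSn rs) ffS ffSl.
  have -> : M + s%:R - (s - r)%:R = M + r%:R by rewrite natrB //; ring.
  have -> : M + s.+1%:R - 1 = M + s%:R by ring.
  (* Without the common factors, the condition of [qb_sum_step] is again a three-term relation. *)
  have E : [[ (s - r).+1%:R ]] * [[ M + 1 + s%:R + r%:R ]] + [[ r%:R ]] * [[ M + r%:R ]] =
    [[ s.+1%:R ]] * [[ M + s.+1%:R ]].
    have := qnDM p r%:R (M + r%:R) (s - r).+1%:R.
    have -> : r%:R + (s - r).+1%:R = s.+1%:R :> V by rewrite -addn1 natrD natrB //; ring.
    have -> : M + r%:R + (s - r).+1%:R = M + s.+1%:R by rewrite -addn1 natrD natrB //; ring.
    have -> : r%:R + (M + r%:R) + (s - r).+1%:R = M + 1 + s%:R + r%:R.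
      by rewrite -addn1 natrD natrB //; ring.
    by move=> ->; rewrite addrC.
  transitivity (([[ (s - r).+1%:R ]] * [[ M + 1 + s%:R + r%:R ]] + [[ r%:R ]] * [[ M + r%:R
    ]]) *
    (ff b r * ff c r * rf (b + c + M + 1) (s - r).+1 * ff (M + s%:R) (s - r))); first ring.
  rewrite E; ring.
- by rewrite !subnn !ff0.
Qed.

End Summation.

Lemma sum_shift (G : nmodType) n r (f : nat -> G) : (r <= n)%N ->
  \sum_(z < n.+1 | (r <= z)%N) f z = \sum_(t < (n - r).+1) f (r + t)%N.
Proof.
move=> rn; rewrite -(big_mkord (fun z => (r <= z)%N) f).
rewrite -(subSn rn) -(big_mkord xpredT (fun t => f (r + t)%N)).
rewrite (big_cat_nat (n := r)) //= ?(leqW rn) // big_nat_cond big1 ?add0r; last first.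
  by move=> i /andP[/andP[_ ir]]; rewrite leqNgt ir.
rewrite -{1}(add0n r) big_addn big_nat_cond [RHS]big_nat_cond.
apply: eq_big => [i|i _]; last by rewrite addnC.
by rewrite leq_addl andbT.
Qed.

Lemma sum_triangle (G : nmodType) n (f : nat -> nat -> G) :
  \sum_(z < n.+1) \sum_(r < z.+1) f z r = \sum_(r < n.+1) \sum_(t < (n - r).+1) f (r + t)%N r.
Proof.
under eq_bigr => z _ do rewrite (big_ord_widen n.+1 (f z) (ltn_ord z)).
rewrite (exchange_big_dep xpredT) //=; apply: eq_bigr => r _.
exact: (@sum_shift _ n r (fun z => f z r) (ltn_ord r)).
Qed.

(** * Sears' transformation *)

Section Sears.
Variables (V : comNzRingType) (F : fieldType) (p : qexponential V F).
Local Notation ff := (qfall p).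
Local Notation rf := (qrise p).
Local Notation fa := (qfac p).
Local Notation qb := (qbinom p).
Implicit Types (x y u v t : V) (m n : nat).

(* 1 / [m - n]!, read as 0 when m < n. *)
Definition qfac_subV m n : F := if (n <= m)%N then (fa (m - n))^-1 else 0.
Local Notation fv := qfac_subV.

Lemma qfac_subVE m n : (n <= m)%N -> fv m n = (fa (m - n))^-1.
Proof. by rewrite /qfac_subV => ->. Qed.

Lemma qfall_subV m n : ff m%:R n = fa m * fv m n.
Proof.
rewrite /qfac_subV; case: leqP => h; last by rewrite mulr0 ff_small.
by rewrite -{2}(subnK h) -ff_nat subnK // mulfK ?fa_neq0.
Qed.

(** The falling factorial cancels the top factors of [m + z - n]!. If it runs past 0 it contains
    [0], which agrees with the value 0 of [fv (m + r) n]. *)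
Lemma qfac_subV_fall m n z r : (r <= z)%N ->
  fv (m + z) n * ff (m%:R - n%:R + z%:R) (z - r) = fv (m + r) n.
Proof.
move=> rz; case: (leqP n (m + z)) => h; last first.
  rewrite {1}/qfac_subV leqNgt h mul0r /qfac_subV leqNgt ifF //; lia.
have -> : m%:R - n%:R + z%:R = (m + z - n)%:R :> V by rewrite natrB // natrD; ring.
rewrite qfall_subV (qfac_subVE h) mulKf ?fa_neq0 // /qfac_subV.
have -> : (z - r <= m + z - n)%N = (n <= m + r)%N by lia.
by have -> : (m + z - n - (z - r) = m + r - n)%N by lia.
Qed.

(** q-Saalschuetz at b = k, c = - x, M = x + y - s, with the product of length s - t traded for one
    of length k - t: both complete to the same product of length s - t + k ([E1], [E2]). The
    hypothesis allows the completing factor to be cancelled. *)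
Lemma q_saalschutz_shifted x y k s :
  rf (x + y + 1 - s%:R + k%:R) s != 0 ->
  \sum_(t < s.+1) qb s t * ((-1) ^+ t * ff k%:R t * rf x t * rf (x + y + 1 - s%:R + t%:R) (k -
    t) *
     rf (y + k%:R - s%:R + 1) (s - t)) = rf (x + y + 1) k * ff y s.
Proof.
move=> h; apply: (mulIf h); rewrite mulr_suml.
have := q_saalschutz p k%:R (- x) (x + y - s%:R) s.
have -> : - x + (x + y - s%:R) + 1 = y - s%:R + 1 by ring.
rewrite -(ffE p y) => E; rewrite -[RHS]mulrA [X in _ * X]mulrC.
have -> : x + y + 1 - s%:R + k%:R = k%:R + (x + y - s%:R) + 1 by ring.
rewrite -E mulr_sumr; apply: eq_bigr => t _.
have ts : (t <= s)%N by rewrite -ltnS.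
rewrite ffN.
have -> : k%:R - x + (x + y - s%:R) + 1 = y + k%:R - s%:R + 1 by ring.
have -> : x + y - s%:R + s%:R = x + y by ring.
case: (leqP t k) => tk; last by rewrite ff_small // !(mulr0, mul0r).
have -> : ff (x + y) (s - t) = rf (x + y + 1 - s%:R + t%:R) (s - t).
  by rewrite ffE; congr rf; rewrite natrB //; ring.
have E1 : rf (x + y + 1 - s%:R + t%:R) (s - t) * rf (x + y + 1) k =
   rf (x + y + 1 - s%:R + t%:R) (s - t + k).
  by rewrite rfD; congr (_ * rf _ _); rewrite natrB //; ring.
have E2 : rf (x + y + 1 - s%:R + t%:R) (k - t) * rf (k%:R + (x + y - s%:R) + 1) s =
   rf (x + y + 1 - s%:R + t%:R) (s - t + k).
  have -> : (s - t + k = (k - t) + s)%N by lia.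
  by rewrite rfD; congr (_ * rf _ _); rewrite natrB //; ring.
transitivity (qb s t * ((-1) ^+ t * ff k%:R t * rf x t * rf (y + k%:R - s%:R + 1) (s - t)) *
  (rf (x + y + 1 - s%:R + t%:R) (k - t) * rf (k%:R + (x + y - s%:R) + 1) s)); first by ring.
by rewrite E2 -E1; ring.
Qed.

(* Sears' transformation of terminating balanced 4phi3 series: expanding two of
   the factors by q-Saalschuetz makes the inner sum again q-Saalschuetz. *)
Lemma q_sears x1 x2 x3 N J k :
  (J <= N)%N -> (k <= N)%N ->
  let L := x1 + x2 + x3 - N%:R - N%:R + 2 in
  rf (L + N%:R - J%:R) J != 0 ->
  rf L (N - k) * \sum_(z < J.+1) (-1) ^+ z * rf (L + N%:R - J%:R - k%:R + z%:R) (k - z) *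
    (rf (x1 - J%:R + 1) z * rf (x2 - J%:R + 1) (J - z) * rf (x3 - k%:R + 1) z) *
    (fv (N + z) (J + k) * fv k z / (fa z * fa (J - z))) =
  \sum_(z < J.+1) (-1) ^+ z * rf L (N - z) *
    (ff (x1 - N%:R + k%:R) z * ff (x3 - N%:R + J%:R) z * ff (x2 - k%:R) (J - z)) *
    (fv (N + z) (J + k) * fv k z / (fa z * fa (J - z))).
Proof.
move=> JN kN L hL.
pose g z r := (-1) ^+ z * rf (L + N%:R - J%:R - k%:R + z%:R) (k - z) *
   rf (x2 - J%:R + 1) (J - z) * fv k z / (fa z * fa (J - z)) *
   (fv (N + r) (J + k) * qb z r * ff (x1 - N%:R + k%:R) r * ff (x3 - N%:R + J%:R) r *
    rf (x1 + x3 - N%:R + 1) (z - r)).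
transitivity (rf L (N - k) * \sum_(z < J.+1) \sum_(r < z.+1) g z r).
  congr (_ * _); apply: eq_bigr => z _.
  (* The parameters make b + M + 1 = x1 - J + 1 and c + M + 1 = x3 - k + 1. The remaining factor
     [ff (M + z) (z - r)] turns [fv (N + z) (J + k)] into [fv (N + r) (J + k)], which is free of
     z. *)
  have := q_saalschutz p (x1 - N%:R + k%:R) (x3 - N%:R + J%:R) (N%:R - J%:R - k%:R) z.
  have -> : x1 - N%:R + k%:R + (N%:R - J%:R - k%:R) + 1 = x1 - J%:R + 1 by ring.
  have -> : x3 - N%:R + J%:R + (N%:R - J%:R - k%:R) + 1 = x3 - k%:R + 1 by ring.
  rewrite (mulrAC (rf (x1 - J%:R + 1) z)) => <-; rewrite !(mulr_sumr, mulr_suml).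
  apply: eq_bigr => r _; have rz : (r <= z)%N by rewrite -ltnS.
  rewrite /g -(qfac_subV_fall _ _ rz) natrD.
  have -> : x1 - N%:R + k%:R + (x3 - N%:R + J%:R) + (N%:R - J%:R - k%:R) + 1 = x1 + x3 - N%:R
    + 1 by ring.
  have -> : N%:R - (J%:R + k%:R) + z%:R = N%:R - J%:R - k%:R + z%:R :> V by ring.
  ring.
rewrite sum_triangle mulr_sumr; apply: eq_bigr => r _.
have rJ : (r <= J)%N by rewrite -ltnS.
case: (leqP r k) => rk; last first.
  rewrite {2}/qfac_subV leqNgt rk /= mulr0 mul0r mulr0 big1 ?mulr0 // => t _.
  by rewrite /g /(qfac_subV k) leqNgt ltn_addr //= mulr0 !mul0r.
(* The inner sum over t = z - r. Its value contains [rf (L + (N - k)) (k - r)], which [rf L (N - k)]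
   completes to [rf L (N - r)]. *)
have := @q_saalschutz_shifted (x1 + x3 - N%:R + 1) (x2 - k%:R) (k - r) (J - r).
have -> : x1 + x3 - N%:R + 1 + (x2 - k%:R) + 1 - (J - r)%:R + (k - r)%:R = L + N%:R - J%:R.
  by rewrite /L !natrB //; ring.
have h' : rf (L + N%:R - J%:R) (J - r) != 0.
  by move: hL; rewrite -{2}(subnK rJ) rfD mulf_eq0 negb_or => /andP[].
move=> /(_ h').
have -> : x1 + x3 - N%:R + 1 + (x2 - k%:R) + 1 = L + (N - k)%:R by rewrite /L natrB //; ring.
move=> E.
have -> : (N - r = (N - k) + (k - r))%N by lia.
rewrite rfD.
transitivity ((-1) ^+ r * rf L (N - k) * (ff (x1 - N%:R + k%:R) r * ff (x3 - N%:R + J%:R) r) *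
  (fv (N + r) (J + k) * fv k r / (fa r * fa (J - r))) * (rf (L + (N - k)%:R) (k - r) * ff (x2
    - k%:R) (J - r)));
  last by ring.
rewrite -E !mulr_sumr; apply: eq_bigr => t _.
have tJ : (t <= J - r)%N by rewrite -ltnS.
rewrite /g /qbinom qfall_subV (qfac_subVE rk) exprD addKn subnDA.
have -> : fv k (r + t) = fv (k - r) t.
  by rewrite /qfac_subV subnDA leq_subRL // addnC.
have -> : L + N%:R - J%:R - k%:R + (r + t)%:R = L + (N - k)%:R - (J - r)%:R + t%:R.
  by rewrite !natrB // natrD; ring.
have -> : x2 - k%:R + (k - r)%:R - (J - r)%:R + 1 = x2 - J%:R + 1 by rewrite !natrB //; ring.
rewrite subnDA.
have := fa_neq0 p r; have := fa_neq0 p (k - r); have := fa_neq0 p (r + t).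
have := fa_neq0 p t; have := fa_neq0 p (J - r); have := fa_neq0 p (J - r - t).
move=> *; field; repeat (apply/andP; split); assumption.
Qed.

End Sears.

(** [pre1 f] and [pre2 f] are the coordinates after F acts on one factor alone. F shifts the basis
    F^m v, and the value 0 at the boundary says that v itself is not reached. *)
Definition pre1 (G : nmodType) (f : nat -> nat -> G) m1 m2 : G :=
  if m1 is k.+1 then f k m2 else 0.
Definition pre2 (G : nmodType) (f : nat -> nat -> G) m1 m2 : G :=
  if m2 is k.+1 then f m1 k else 0.

(** * Two Verma modules: singular vectors, their descendants, the functional *)

Section Coefficients.
Variables (V : comNzRingType) (F : fieldType) (p : qexponential V F).
Local Notation "[[ x ]]" := (qn p x) (at level 0).
Local Notation ff := (qfall p).
Local Notation rf := (qrise p).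
Local Notation fa := (qfac p).
Implicit Types (x y u v t X Y : V) (m n J s : nat).

(* X and Y are twice the highest weights of two Verma modules, with highest
   weight vectors v and w.  The vector
     u = \sum_s sing_coef J X Y s F^s v (x) F^(J - s) w
   is singular, and cg_coef J X Y m1 m2 is the coordinate of F^(m1 + m2 - J) u
   on F^m1 v (x) F^m2 w. *)
Definition sing_coef J X Y s : F :=
  (-1) ^+ s * p ((J - s)%:R * (Y - (J - s)%:R) - s%:R) /
  (fa s * fa (J - s) * ff X s * ff Y (J - s)).
Local Notation sig := sing_coef.

(** The coordinate of F^(z + w) (v (x) v') on F^z v (x) F^w v', where K v = q^x v. It is a
    q-binomial coefficient because F (x) 1 and K^-1 (x) F commute up to a power of q. *)
Definition desc_coef x z w : F := p (z%:R * w%:R - w%:R * x) * fa (z + w) / (fa z * fa w).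
Local Notation bk := desc_coef.

Definition cg_coef J X Y m1 m2 : F :=
  \sum_(s < J.+1 | (s <= m1)%N && (J - s <= m2)%N)
    sig J X Y s * bk (X - 2 * s%:R) (m1 - s) (m2 - (J - s)).
Local Notation Q := cg_coef.

(* The coordinates of E applied to a vector with coordinates f. *)
Definition e_action X Y (f : nat -> nat -> F) m1 m2 : F :=
  p (Y - 2 * m2%:R) * ([[ m1%:R + 1 ]] * [[ X - m1%:R ]]) * f m1.+1 m2 +
  [[ m2%:R + 1 ]] * [[ Y - m2%:R ]] * f m1 m2.+1.

(** The commutator [E, F] in numbers: as E F^m v = [m] [X - m + 1] F^(m - 1) v, the case x = m, y =
    X - m gives E F - F E = [X - 2 m] on F^m v. *)
Lemma qn_step x y : [[ x + 1 ]] * [[ y ]] = [[ x ]] * [[ y + 1 ]] + [[ y - x ]].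
Proof.
have k0 := qexp1_sub_neq0 p.
have : (p (x + 1) - p (- (x + 1))) * (p y - p (- y)) =
  (p x - p (- x)) * (p (y + 1) - p (- (y + 1))) + (p (y - x) - p (- (y - x))) * (p 1 - p (- 1)).
  rewrite !opprD !qexpD !qexpV.
  have := qexp_neq0 p x; have := qexp_neq0 p y; have := qexp_neq0 p 1.
  by move=> h1 h2 h3; field; rewrite h1 h2 h3 oner_neq0.
rewrite /qn /qnumber; move: k0; set k := p 1 - _; move: k => k k0 E.
by rewrite mulrACA E; field.
Qed.

Lemma desc_coef0 x z : bk x z 0 = 1.
Proof.
by rewrite /desc_coef mulr0 mul0r subrr qexp0 addn0 fa0 mulr1 mul1r divff ?fa_neq0.
Qed.

Lemma desc_coef_rec x z w : (0 < z + w)%N ->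
  bk x z w = pre1 (bk x) z w + p (2 * z%:R - x) * pre2 (bk x) z w.
Proof.
case: z w => [|z] [|w] //= _.
- rewrite add0r /desc_coef !add0n fa0 !mul1r !mulfK ?fa_neq0 //.
  by rewrite -qexpD; congr qexp; ring.
- by rewrite !desc_coef0 mulr0 addr0.
- rewrite /desc_coef addSn addnS !faS.
  have -> : [[ (z + w).+2%:R ]] = p (- w.+1%:R) * [[ z.+1%:R ]] + p z.+1%:R * [[ w.+1%:R ]].
    have -> : (z + w).+2%:R = w.+1%:R + z.+1%:R :> V by ring.
    by rewrite qnD addrC.
  have -> : p (z%:R * w.+1%:R - w.+1%:R * x) = p (z.+1%:R * w.+1%:R - w.+1%:R * x) * p (-
    w.+1%:R).
    by rewrite -qexpD; congr qexp; ring.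
  have -> : p (z.+1%:R * w%:R - w%:R * x) =
      p (z.+1%:R * w.+1%:R - w.+1%:R * x) * p z.+1%:R / p (2 * z.+1%:R - x).
    by rewrite -qexpV -!qexpD; congr qexp; ring.
  have := qexp_neq0 p (2 * z.+1%:R - x).
  rewrite ?(addnS z w) ?(addSn z w) ?faS.
  have := fa_neq0 p z; have := fa_neq0 p w; have := fa_neq0 p (z + w).
  have := @qn_nat_neq0 V F p z.+1 isT; have := @qn_nat_neq0 V F p w.+1 isT.
  move=> *; field; repeat (apply/andP; split); assumption.
Qed.

Lemma cg_coef_small J X Y m1 m2 : (m1 + m2 < J)%N -> Q J X Y m1 m2 = 0.
Proof.
by move=> h; rewrite /cg_coef big_pred0 // => s; apply/negP => /andP[? ?]; lia.
Qed.

Lemma cg_coef_level J X Y m1 m2 : (m1 + m2 = J)%N -> Q J X Y m1 m2 = sig J X Y m1.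
Proof.
move=> h; have m1J : (m1 < J.+1)%N by lia.
rewrite /cg_coef (big_pred1 (Ordinal m1J)) => [|s] /=; last first.
  by apply/idP/eqP => [/andP[? ?]|-> /=]; [apply: val_inj => /=; have := ltn_ord s; lia | lia].
have -> : (m2 - (J - m1) = 0)%N by lia.
by rewrite desc_coef0 mulr1.
Qed.

(** F^n u is F applied to F^(n - 1) u. The inequality is strict: at level J stands u, while the
    right-hand side is 0. *)
Lemma cg_coef_f J X Y m1 m2 : (J < m1 + m2)%N ->
  Q J X Y m1 m2 = pre1 (Q J X Y) m1 m2 + p (2 * m1%:R - X) * pre2 (Q J X Y) m1 m2.
Proof.
move=> h.
pose G s m1 m2 := if (s <= m1)%N && (J - s <= m2)%N
  then sig J X Y s * bk (X - 2 * s%:R) (m1 - s) (m2 - (J - s)) else 0.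
have QG a b : Q J X Y a b = \sum_(s < J.+1) G s a b by rewrite /cg_coef big_mkcond.
have -> : pre1 (Q J X Y) m1 m2 = \sum_(s < J.+1) pre1 (G s) m1 m2.
  by case: m1 h => [|m1] _ /=; rewrite ?QG // big1.
have -> : pre2 (Q J X Y) m1 m2 = \sum_(s < J.+1) pre2 (G s) m1 m2.
  by case: m2 h => [|m2] _ /=; rewrite ?QG // big1.
rewrite QG mulr_sumr -big_split /=; apply: eq_bigr => s _.
have [sm1|sm1] := leqP s m1; last first.
  rewrite {1}/G leqNgt sm1 /=.
  have -> : pre1 (G s) m1 m2 = 0 by case: m1 sm1 {h} => //= m1 sm1; rewrite /G ifF //; lia.
  have -> : pre2 (G s) m1 m2 = 0 by case: m2 h => //= m2 h; rewrite /G ifF //; lia.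
  ring.
have [sm2|sm2] := leqP (J - s) m2; last first.
  rewrite {1}/G [(J - s <= m2)%N]leqNgt sm2 andbF.
  have -> : pre1 (G s) m1 m2 = 0 by case: m1 sm1 {h} => //= m1 sm1; rewrite /G ifF //; lia.
  have -> : pre2 (G s) m1 m2 = 0 by case: m2 sm2 {h} => //= m2 h; rewrite /G ifF //; lia.
  ring.
rewrite {1}/G sm1 sm2 /= desc_coef_rec; last by have := ltn_ord s; lia.
have -> : 2 * (m1 - s)%:R - (X - 2 * s%:R) = 2 * m1%:R - X by rewrite natrB //; ring.
rewrite mulrDr mulrCA; congr (_ + _ * _).
- case: m1 sm1 {h} => [|m1] sm1 /=; first by rewrite ?sub0n /= ?mulr0.
  rewrite /G; have [sm|sm] := leqP s m1; first by rewrite subSn // sm2.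
  have -> : (m1.+1 - s = 0)%N by lia.
  by rewrite /= mulr0.
- case: m2 sm2 {h} => [|m2] sm2 /=; first by rewrite ?sub0n /= ?mulr0.
  rewrite /G; have [sm|sm] := leqP (J - s) m2; first by rewrite subSn // sm1.
  have -> : (m2.+1 - (J - s) = 0)%N by lia.
  by rewrite andbF /= mulr0.
Qed.

(** Irreducibility of the Verma module: E F^(n + 1) v = [n + 1] [X - n] F^n v never vanishes. *)
Definition nonintegral X := forall n, [[ X - n%:R ]] != 0.
Local Notation nz := nonintegral.

Lemma ff_neq0 X n : nz X -> ff X n != 0.
Proof. by move=> h; apply/prodf_neq0 => i _; exact: h. Qed.

Lemma sing_coef_neq0 J X Y s : nz X -> nz Y -> sig J X Y s != 0.
Proof.
move=> hX hY; rewrite /sing_coef !mulf_neq0 ?signr_eq0 ?qexp_neq0 //.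
by rewrite invr_neq0 // !mulf_neq0 ?fa_neq0 ?ff_neq0.
Qed.

Lemma sing_coef_singular J X Y m1 m2 : nz X -> nz Y -> (m1 + m2).+1 = J ->
  p (Y - 2 * m2%:R) * ([[ m1%:R + 1 ]] * [[ X - m1%:R ]]) * sig J X Y m1.+1 +
  [[ m2%:R + 1 ]] * [[ Y - m2%:R ]] * sig J X Y m1 = 0.
Proof.
move=> hX hY h; rewrite /sing_coef.
have -> : (J - m1.+1 = m2)%N by lia.
have -> : (J - m1 = m2.+1)%N by lia.
rewrite !natr1 !faS !ffS exprS.
have -> : p (m2%:R * (Y - m2%:R) - m1.+1%:R) =
  p (m2.+1%:R * (Y - m2.+1%:R) - m1%:R) * p (- (Y - 2 * m2%:R)).
  by rewrite -qexpD; congr qexp; ring.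
rewrite qexpV.
have := fa_neq0 p m1; have := fa_neq0 p m2; have := ff_neq0 m1 hX; have := ff_neq0 m2 hY.
have := hX m1; have := hY m2; have := qexp_neq0 p (Y - 2 * m2%:R).
have := @qn_nat_neq0 V F p m1.+1 isT; have := @qn_nat_neq0 V F p m2.+1 isT.
move=> *; field; repeat (apply/andP; split); assumption.
Qed.

(** Induction on the level by E F^(n + 1) u = F E F^n u + [E, F] F^n u, starting from E u = 0. *)
Lemma cg_coef_e J X Y m1 m2 : nz X -> nz Y -> (J <= (m1 + m2).+1)%N ->
  e_action X Y (Q J X Y) m1 m2 =
  [[ (m1 + m2)%:R - J%:R + 1 ]] * [[ X + Y - J%:R - (m1 + m2)%:R ]] * Q J X Y m1 m2.
Proof.
move=> hX hY; move: {2}(m1 + m2)%N.+1 (ltnSn (m1 + m2)%N) => n.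
elim: n m1 m2 => // n IH m1 m2 hn hJ.
have [Jn|Jn] := eqVneq J (m1 + m2).+1.
  rewrite (@cg_coef_small J X Y m1 m2) ?Jn // mulr0 /e_action.
  by rewrite !cg_coef_level ?sing_coef_singular // ?addSn ?addnS.
have {}Jn : (J <= m1 + m2)%N by lia.
rewrite /e_action (@cg_coef_f J X Y m1.+1 m2) ?(@cg_coef_f J X Y m1 m2.+1) ?addSn ?addnS //=.
(* [E1] and [E2] are the induction hypothesis one step lower in the first and in the second index;
   at the boundary both sides are 0. *)
have E1 : p (Y - 2 * m2%:R) * ([[ m1%:R ]] * [[ X - m1%:R + 1 ]]) * Q J X Y m1 m2 +
   [[ m2%:R + 1 ]] * [[ Y - m2%:R ]] * pre1 (Q J X Y) m1 m2.+1 =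
   [[ (m1 + m2)%:R - J%:R ]] * [[ X + Y - J%:R - (m1 + m2)%:R + 1 ]] * pre1 (Q J X Y) m1 m2.
  case: m1 hn Jn {hJ} => [|m1] hn Jn; first by rewrite qn0 /=; ring.
  have := IH m1 m2 ltac:(lia) ltac:(lia); rewrite /e_action /= => E.
  have -> : (m1.+1 + m2)%:R - J%:R = (m1 + m2)%:R - J%:R + 1 :> V by ring.
  have -> : X + Y - J%:R - (m1.+1 + m2)%:R + 1 = X + Y - J%:R - (m1 + m2)%:R by ring.
  have -> : X - m1.+1%:R + 1 = X - m1%:R by ring.
  by rewrite -E !natr1.
have E2 : p (Y - 2 * m2%:R + 2) * ([[ m1%:R + 1 ]] * [[ X - m1%:R ]]) * pre2 (Q J X Y) m1.+1
  m2 +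
   [[ m2%:R ]] * [[ Y - m2%:R + 1 ]] * Q J X Y m1 m2 =
   [[ (m1 + m2)%:R - J%:R ]] * [[ X + Y - J%:R - (m1 + m2)%:R + 1 ]] * pre2 (Q J X Y) m1 m2.
  case: m2 hn Jn {hJ E1} => [|m2] hn Jn; first by rewrite qn0 /=; ring.
  have := IH m1 m2 ltac:(lia) ltac:(lia); rewrite /e_action /= => E.
  have -> : (m1 + m2.+1)%:R - J%:R = (m1 + m2)%:R - J%:R + 1 :> V by ring.
  have -> : X + Y - J%:R - (m1 + m2.+1)%:R + 1 = X + Y - J%:R - (m1 + m2)%:R by ring.
  have -> : Y - m2.+1%:R + 1 = Y - m2%:R by ring.
  have -> : Y - 2 * m2.+1%:R + 2 = Y - 2 * m2%:R by ring.
  by rewrite -E !natr1.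
have E3 : [[ (m1 + m2)%:R - J%:R ]] * [[ X + Y - J%:R - (m1 + m2)%:R + 1 ]] *
    (pre1 (Q J X Y) m1 m2 + p (2 * m1%:R - X) * pre2 (Q J X Y) m1 m2) =
    [[ (m1 + m2)%:R - J%:R ]] * [[ X + Y - J%:R - (m1 + m2)%:R + 1 ]] * Q J X Y m1 m2.
  case: (ltngtP J (m1 + m2)) Jn => // [h|->] _; first by rewrite -cg_coef_f.
  by rewrite subrr qn0; ring.
have {}E3 := esym E3; rewrite mulrDr (mulrCA (_ * _) (p _)) -E1 -E2 in E3.
rewrite (qn_step (_ - J%:R)) (mulrDl _ _ (Q J X Y m1 m2)) E3.
rewrite (qn_step m1%:R) (qn_step m2%:R).
have -> : X + Y - J%:R - (m1 + m2)%:R - ((m1 + m2)%:R - J%:R) =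
  X - m1%:R - m1%:R + (Y - m2%:R - m2%:R) by ring.
rewrite (qnD _ (X - m1%:R - m1%:R)).
have -> : - (X - m1%:R - m1%:R) = 2 * m1%:R - X by ring.
have -> : Y - m2%:R - m2%:R = Y - 2 * m2%:R by ring.
have -> : 2 * m1.+1%:R - X = 2 * m1%:R - X + 2 by ring.
rewrite !(qexpD _ _ 2); ring.
Qed.

(* The functional on level k, unique up to a scalar, that vanishes on the image of F. *)
Definition sing_form X k (f : nat -> nat -> F) : F :=
  \sum_(m < k.+1) (-1) ^+ m * p (m%:R * (m%:R - 1) - m%:R * X) * f m (k - m)%N.
Local Notation Phi := sing_form.

(** The coefficients are such that the contribution of [pre1] at m + 1 cancels that of [pre2] at
    m. *)
Lemma sing_form_f X k f :
  (forall m1 m2, (m1 + m2 = k.+1)%N ->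
     f m1 m2 = pre1 f m1 m2 + p (2 * m1%:R - X) * pre2 f m1 m2) ->
  Phi X k.+1 f = 0.
Proof.
move=> H; rewrite /sing_form.
under eq_bigr => m _ do rewrite (H m (k.+1 - m)%N (@subnKC m k.+1 (ltn_ord m))) mulrDr.
rewrite big_split /= big_ord_recl /= mulr0 add0r.
rewrite [X in _ + X]big_ord_recr /= subnn /= !mulr0 addr0 -big_split /=.
apply: big1 => m _; rewrite /bump /= add1n subSS.
have mk : (m <= k)%N by rewrite -ltnS.
rewrite (subSn mk) /= exprS.
have -> : p (m.+1%:R * (m.+1%:R - 1) - m.+1%:R * X) = p (m%:R * (m%:R - 1) - m%:R * X) * p (2
  * m%:R - X).
  by rewrite -qexpD; congr qexp; ring.
ring.
Qed.

Lemma sing_form_cg J X Y k : (J < k)%N -> Phi X k (Q J X Y) = 0.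
Proof. by case: k => // k h; apply: sing_form_f => m1 m2 e; apply: cg_coef_f; rewrite e. Qed.

Lemma sing_form_sing X Y k : nz X -> nz Y ->
  \sum_(m < k.+1) (-1) ^+ m * p (m%:R * (m%:R - 1) - m%:R * X) * sig k X Y m =
  p (- k%:R) * rf (X + Y - 2 * k%:R + 2) k / (fa k * ff X k * ff Y k).
Proof.
move=> hX hY.
have -> : X + Y - 2 * k%:R + 2 = (X - k%:R + 1) + (Y - k%:R + 1) by ring.
rewrite -q_vandermonde mulr_sumr mulr_suml; apply: eq_bigr => m _.
have mk : (m <= k)%N by rewrite -ltnS.
have EX : ff X k = ff X m * rf (X - k%:R + 1) (k - m).
  rewrite -{1}(subnKC mk) ffD (ffE _ (X - _)); congr (_ * rf _ _).
  by rewrite natrB //; ring.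
have EY : ff Y k = ff Y (k - m) * rf (Y - k%:R + 1) m.
  rewrite -{1}(subnK mk) ffD (ffE _ (Y - _)); congr (_ * rf _ _).
  by rewrite natrB //; ring.
have := ff_neq0 k hX; have := ff_neq0 k hY; rewrite EX EY !mulf_eq0 !negb_or.
move=> /andP[y1 y2] /andP[x1 x2].
rewrite /sing_coef /qbinom.
have -> : (-1) ^+ m * p (m%:R * (m%:R - 1) - m%:R * X) *
  ((-1) ^+ m * p ((k - m)%:R * (Y - (k - m)%:R) - m%:R) / (fa m * fa (k - m) * ff X m * ff Y
    (k - m))) =
  p (- k%:R) * p ((k - m)%:R * (Y - k%:R + 1) - m%:R * (X - k%:R + 1)) / (fa m * fa (k - m) *
    ff X m * ff Y (k - m)).
  rewrite !mulrA (mulrAC ((-1) ^+ m)) -expr2 sqrr_sign mul1r -!qexpD; congr (p _ / _).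
  by rewrite !natrB //; ring.
have := fa_neq0 p m; have := fa_neq0 p (k - m); have := fa_neq0 p k.
move: y1 y2 x1 x2 => *; field; repeat (apply/andP; split); assumption.
Qed.

(** The vanishing of E is a two-term recursion along level k, so f is a multiple of the singular
    vector; the functional, nonzero there, makes the multiple 0. *)
Lemma e_action_eq0 X Y k (f : nat -> nat -> F) : nz X -> nz Y ->
  rf (X + Y - 2 * k%:R + 2) k != 0 ->
  (forall m1 m2, (m1 + m2).+1 = k -> e_action X Y f m1 m2 = 0) -> Phi X k f = 0 ->
  forall m1 m2, (m1 + m2 = k)%N -> f m1 m2 = 0.
Proof.
move=> hX hY hk H HPhi.
pose c := f 0%N k / sig k X Y 0.
have E m : (m <= k)%N -> f m (k - m)%N = c * sig k X Y m.
  elim: m => [|m IH] mk; first by rewrite subn0 /c divfK ?sing_coef_neq0.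
  have h : (m + (k - m.+1)).+1 = k by lia.
  have := H _ _ h; rewrite /e_action (subnSK mk) IH; last by lia.
  have := sing_coef_singular hX hY h.
  set A := p _ * _; set B := [[ _ ]] * [[ _ ]] => E1 E2.
  have A0 : A != 0.
    by apply: mulf_neq0 (qexp_neq0 _ _) (mulf_neq0 _ (hX m)); rewrite natr1 qn_nat_neq0.
  apply: (mulfI A0); move/eqP: E2; rewrite addr_eq0 => /eqP ->.
  move/eqP: E1; rewrite addr_eq0 => /eqP E1.
  by rewrite (mulrCA A) E1; ring.
have c0 : c = 0.
  apply/eqP; move: HPhi; rewrite /sing_form.
  under eq_bigr => m _ do rewrite (E m (ltn_ord m)) mulrCA.
  rewrite -mulr_sumr sing_form_sing // => /eqP; rewrite mulf_eq0 => /orP[//|].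
  rewrite !mulf_eq0 invr_eq0 !mulf_eq0 (negPf (qexp_neq0 _ _)) (negPf hk).
  by rewrite (negPf (fa_neq0 _ _)) !(negPf (ff_neq0 _ _)).
move=> m1 m2 h; have -> : m2 = (k - m1)%N by lia.
by rewrite E ?c0 ?mul0r //; lia.
Qed.

End Coefficients.

(** * Three Verma modules: action of F and E on the two couplings *)

Section Recoupling.
Variables (V : comNzRingType) (F : fieldType) (p : qexponential V F).
Local Notation "[[ x ]]" := (qn p x) (at level 0).
Local Notation rf := (qrise p).
Local Notation Q := (cg_coef p).
Local Notation e_action := (e_action p).
Local Notation Phi := (sing_form p).
Local Notation nz := (nonintegral p).
Implicit Types (f : nat -> nat -> nat -> F) (X Y : V) (J k m n N : nat).

(** The products on the right are the coordinates of the sum of g n F^n u, on which F acts by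
    shifting g. The truncated difference does no harm, as Q is 0 below level J. *)
Lemma cg_coef_mul_f J X Y (g : nat -> F) a b :
  Q J X Y a b * (if (a + b - J)%N is n.+1 then g n else 0) =
  pre1 (fun a b => Q J X Y a b * g (a + b - J)%N) a b +
  p (2 * a%:R - X) * pre2 (fun a b => Q J X Y a b * g (a + b - J)%N) a b.
Proof.
case: (ltngtP J (a + b)) => h; last first.
- have -> : (a + b - J = 0)%N by lia.
  rewrite mulr0; case: a b h => [|a] [|b] h /=; rewrite ?(@cg_coef_small _ _ p J) ?mul0r
    ?mulr0 ?addr0 //; lia.
- rewrite cg_coef_small // mul0r.
  case: a b h => [|a] [|b] h /=; rewrite ?(@cg_coef_small _ _ p J) ?mul0r ?mulr0 ?addr0 //; lia.
have -> : (a + b - J = (a + b - J).-1.+1)%N by lia.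
rewrite cg_coef_f // mulrDl -mulrA; congr (_ + _ * _).
- case: a h => [|a] h /=; first by rewrite mul0r.
  by congr (_ * g _); lia.
- case: b h => [|b] h /=; first by rewrite mul0r.
  by congr (_ * g _); lia.
Qed.

Section Fixed.
Variables (X1 X2 X3 : V) (N : nat).
Hypotheses (hX1 : nz X1) (hX2 : nz X2) (hX3 : nz X3).

(* The part of f on each level n > N is F applied to the part on level n - 1. *)
Definition f_stable f := forall m1 m2 m3, (N < m1 + m2 + m3)%N ->
  f m1 m2 m3 = pre1 (fun a b => f a b m3) m1 m2 +
   p (2 * m1%:R - X1) * (pre1 (f m1) m2 m3 + p (2 * m2%:R - X2) * pre2 (f m1) m2 m3).

Definition e_action3 f m1 m2 m3 : F :=
  p (X3 - 2 * m3%:R) * e_action X1 X2 (fun a b => f a b m3) m1 m2 +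
  [[ m3%:R + 1 ]] * [[ X3 - m3%:R ]] * f m1 m2 m3.+1.

Lemma f_stable_eq0 f : f_stable f ->
  (forall m1 m2 m3, (m1 + m2 + m3 = N)%N -> f m1 m2 m3 = 0) ->
  forall m1 m2 m3, (N <= m1 + m2 + m3)%N -> f m1 m2 m3 = 0.
Proof.
move=> Hf H0 m1 m2 m3; move: {2}(m1 + m2 + m3)%N (erefl (m1 + m2 + m3)%N) => n.
elim: n m1 m2 m3 => [|n IH] m1 m2 m3 hn hN; first by apply: H0; lia.
have [e|ne] := eqVneq N (m1 + m2 + m3)%N; first by apply: H0.
have {ne}hN : (N < m1 + m2 + m3)%N by lia.
rewrite Hf //.
have -> : pre1 (fun a b => f a b m3) m1 m2 = 0 by case: m1 hn hN => //= m1 hn hN; apply: IH;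
  lia.
have -> : pre1 (f m1) m2 m3 = 0 by case: m2 hn hN => //= m2 hn hN; apply: IH; lia.
have -> : pre2 (f m1) m2 m3 = 0 by case: m3 hn hN => //= m3 hn hN; apply: IH; lia.
ring.
Qed.

(* By induction on M = m2 + m3: once the slices below M vanish, the slice at M
   is a singular vector of the last two factors, and Phi detects it. *)
Lemma singular_eq0 f :
  (forall m1 m2 m3, (m1 + m2 + m3).+1 = N -> e_action3 f m1 m2 m3 = 0) ->
  (forall k, rf (X2 + X3 - 2 * k%:R + 2) k != 0) ->
  (forall k, (k <= N)%N -> Phi X2 k (f (N - k)%N) = 0) ->
  forall m1 m2 m3, (m1 + m2 + m3 = N)%N -> f m1 m2 m3 = 0.
Proof.
move=> HE hr HPhi m1 m2 m3; move: {2}(m2 + m3)%N.+1 (ltnSn (m2 + m3)%N) => n.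
elim: n m1 m2 m3 => // n IH m1 m2 m3 hn hN.
have [h|h] := ltnP (m2 + m3) n; first exact: IH.
have e : (m2 + m3)%N = n by lia.
have -> : m1 = (N - n)%N by lia.
have kN : (n <= N)%N by lia.
apply: (e_action_eq0 hX2 hX3 (hr n) _ (HPhi n kN) e) => a b ab.
(* Here E on the first factor leads to a slice with m2 + m3 = n - 1, already known to be 0. *)
have := HE (N - n)%N a b; rewrite /e_action3 {1}/e_action (IH (N - n).+1) ?mulr0 ?add0r; try
  lia.
move=> <-; last by lia.
by rewrite /e_action; ring.
Qed.

(* The two couplings, up to scalars, in the basis F^m1 v1 (x) F^m2 v2 (x) F^m3 v3. *)
Definition W12 J m1 m2 m3 : F :=
  Q J X1 X2 m1 m2 * Q (N - J) (X1 + X2 - 2 * J%:R) X3 (m1 + m2 - J) m3.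

Definition W23 k m1 m2 m3 : F :=
  Q k X2 X3 m2 m3 * Q (N - k) X1 (X2 + X3 - 2 * k%:R) m1 (m2 + m3 - k).

Lemma W12_f_stable J : (J <= N)%N -> f_stable (W12 J).
Proof.
move=> JN m1 m2 m3 h.
have [h1|h1] := ltnP (m1 + m2) J.
  rewrite /W12 cg_coef_small // mul0r.
  case: m1 m2 m3 h h1 => [|m1] [|m2] [|m3] h h1 /=; rewrite ?(@cg_coef_small _ _ p J) ?mul0r
    //; try lia; ring.
have := cg_coef_mul_f J X1 X2 (fun n => Q (N - J) (X1 + X2 - 2 * J%:R) X3 n m3) m1 m2.
rewrite /W12 (@cg_coef_f _ _ _ (N - J)); last by lia.
rewrite mulrDr => E.
(* K^-1 on the coupled module is K^-1 (x) K^-1 on its two factors. *)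
have -> : p (2 * (m1 + m2 - J)%:R - (X1 + X2 - 2 * J%:R)) = p (2 * m1%:R - X1) * p (2 * m2%:R
  - X2).
  by rewrite -qexpD natrB //; congr qexp; ring.
rewrite [X in X + _]E; case: m2 {h h1 E} => [|m2]; case: m3 => [|m3] /=; ring.
Qed.

Lemma W23_f_stable k : (k <= N)%N -> f_stable (W23 k).
Proof.
move=> kN m1 m2 m3 h.
have [h1|h1] := ltnP (m2 + m3) k.
  rewrite /W23 cg_coef_small // mul0r.
  case: m1 m2 m3 h h1 => [|m1] [|m2] [|m3] h h1 /=; rewrite ?(@cg_coef_small _ _ p k) ?mul0r
    //; try lia; ring.
have := cg_coef_mul_f k X2 X3 (fun n => Q (N - k) X1 (X2 + X3 - 2 * k%:R) m1 n) m2 m3.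
rewrite {1}/W23 (@cg_coef_f _ _ _ (N - k)); last by lia.
rewrite mulrDr mulrCA -/(pre2 (Q (N - k) X1 (X2 + X3 - 2 * k%:R)) m1 _) => ->.
by case: m1 {h} => [|m1] /=; rewrite ?mulr0 /W23.
Qed.

(** On the span of the F^n u, E acts as on a single Verma module of doubled highest weight X + Y - 2
    J. *)
Lemma e_action_mul J X Y (g : nat -> F) m1 m2 : nz X -> nz Y ->
  e_action X Y (fun a b => Q J X Y a b * g (a + b - J)%N) m1 m2 =
  Q J X Y m1 m2 *
   ([[ (m1 + m2 - J)%:R + 1 ]] * [[ X + Y - 2 * J%:R - (m1 + m2 - J)%:R ]] * g (m1 + m2 -
     J).+1).
Proof.
move=> hX hY; have [h|h] := ltnP (m1 + m2).+1 J.
  by rewrite /e_action !cg_coef_small ?addSn ?addnS //; [ring | lia].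
have -> : e_action X Y (fun a b => Q J X Y a b * g (a + b - J)%N) m1 m2 =
   e_action X Y (Q J X Y) m1 m2 * g ((m1 + m2).+1 - J)%N.
  by rewrite /e_action addSn addnS; ring.
rewrite cg_coef_e //; have [e|ne] := eqVneq J (m1 + m2).+1.
  by rewrite cg_coef_small ?e // mulr0 !mul0r.
have h1 : (J <= m1 + m2)%N by lia.
rewrite (subSn h1) natrB //.
have -> : X + Y - 2 * J%:R - ((m1 + m2)%:R - J%:R) = X + Y - J%:R - (m1 + m2)%:R by ring.
ring.
Qed.

Lemma W12_singular J m1 m2 m3 : (J <= N)%N -> nz (X1 + X2 - 2 * J%:R) ->
  (m1 + m2 + m3).+1 = N -> e_action3 (W12 J) m1 m2 m3 = 0.
Proof.
move=> JN hX12 h; rewrite /e_action3 {1}/W12.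
rewrite (e_action_mul J (fun n => Q (N - J) (X1 + X2 - 2 * J%:R) X3 n m3)) // /W12.
have [h1|h1] := ltnP (m1 + m2) J; first by rewrite cg_coef_small // !(mul0r, mulr0) addr0.
have := @cg_coef_e _ _ p (N - J) (X1 + X2 - 2 * J%:R) X3 (m1 + m2 - J) m3 hX12 hX3.
move=> /(_ ltac:(lia)).
(* The point lies one level below the outer singular vector, so the eigenvalue in [cg_coef_e]
   contains [0]. *)
have -> : (m1 + m2 - J + m3)%:R - (N - J)%:R + 1 = 0 :> V.
  have -> : (m1 + m2 - J + m3)%N = ((N - J) - 1)%N by lia.
  by rewrite natrB; [ring | lia].
rewrite qn0 !mul0r /e_action => E.
by rewrite -[RHS](mulr0 (Q J X1 X2 m1 m2)) -E; ring.
Qed.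

Lemma W23_singular k m1 m2 m3 : (k <= N)%N -> nz (X2 + X3 - 2 * k%:R) ->
  (m1 + m2 + m3).+1 = N -> e_action3 (W23 k) m1 m2 m3 = 0.
Proof.
move=> kN hX23 h.
(* Coassociativity: E is regrouped with the last two factors together. *)
transitivity (p (X2 + X3 - 2 * m2%:R - 2 * m3%:R) * ([[ m1%:R + 1 ]] * [[ X1 - m1%:R ]]) * W23
  k m1.+1 m2 m3 +
   e_action X2 X3 (W23 k m1) m2 m3).
  rewrite /e_action3 /e_action; have -> : X2 + X3 - 2 * m2%:R - 2 * m3%:R = (X3 - 2 * m3%:R) +
    (X2 - 2 * m2%:R) by ring.
  rewrite (qexpD _ (X3 - 2 * m3%:R)); ring.
rewrite (e_action_mul k (fun n => Q (N - k) X1 (X2 + X3 - 2 * k%:R) m1 n)) // /W23.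
have [h1|h1] := ltnP (m2 + m3) k; first by rewrite cg_coef_small // !(mul0r, mulr0) addr0.
have := @cg_coef_e _ _ p (N - k) X1 (X2 + X3 - 2 * k%:R) m1 (m2 + m3 - k) hX1 hX23.
move=> /(_ ltac:(lia)).
have -> : (m1 + (m2 + m3 - k))%:R - (N - k)%:R + 1 = 0 :> V.
  have -> : (m1 + (m2 + m3 - k))%N = ((N - k) - 1)%N by lia.
  by rewrite natrB; [ring | lia].
rewrite qn0 !mul0r /e_action => E.
have -> : X2 + X3 - 2 * m2%:R - 2 * m3%:R = X2 + X3 - 2 * k%:R - 2 * (m2 + m3 - k)%:R.
  by rewrite natrB //; ring.
by rewrite -[RHS](mulr0 (Q k X2 X3 m2 m3)) -E; ring.
Qed.

End Fixed.
End Recoupling.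

(** * The recoupling coefficients *)

Section Expansion.
Variables (V : comNzRingType) (F : fieldType) (p : qexponential V F).
Local Notation ff := (qfall p).
Local Notation rf := (qrise p).
Local Notation fa := (qfac p).
Local Notation qb := (qbinom p).
Local Notation sig := (sing_coef p).
Local Notation Q := (cg_coef p).
Local Notation bk := (desc_coef p).
Local Notation Phi := (sing_form p).
Local Notation nz := (nonintegral p).
Local Notation fv := (qfac_subV p).
Implicit Types (f : nat -> nat -> nat -> F) (X Y : V) (J k m n N : nat).

Lemma ff_split X a b : ff X (a + b) = ff X a * rf (X - (a + b)%:R + 1) b.
Proof. by rewrite ffD (ffE p (X - _)); congr (_ * rf _ _); ring. Qed.

Lemma nonintegral_shift X n : nz X -> nz (X - n%:R).
Proof. by move=> h m; rewrite -addrA -opprD -natrD. Qed.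

Lemma qrise_nonintegral X Y n : nz X -> (forall j, (j < n)%N -> exists i, Y + j%:R = X - i%:R)
  -> rf Y n != 0.
Proof.
by move=> hX h; apply/prodf_neq0 => j _; have [i ->] := h j (ltn_ord j); exact: hX.
Qed.

Lemma cg_coef_col0 J X Y m : (J <= m)%N -> Q J X Y m 0 = sig J X Y J.
Proof.
move=> h; rewrite /cg_coef (big_pred1 ord_max) => [|s] /=; last first.
  by apply/idP/eqP => [/andP[? ?]|-> /=]; [apply: val_inj => /=; have := ltn_ord s; lia | lia].
by rewrite subnn desc_coef0 mulr1.
Qed.

(** One term of the double sum in [sing_form_W12], with J = s + z, N - k = s + u and k = z + i + w,
    so that no truncated subtraction is left. Its dependence on i is that of a q-Vandermonde
    summand. *)
Lemma sing_form_term X1 X2 X3 s z u i w : nz X1 -> nz X2 -> nz X3 ->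
  let X12 := X1 + X2 - 2 * (s + z)%:R in nz X12 ->
  (-1) ^+ (z + i) * p ((z + i)%:R * ((z + i)%:R - 1) - (z + i)%:R * X2) *
    (sig (s + z) X1 X2 s * bk (X1 - 2 * s%:R) u i * sig (u + (i + w)) X12 X3 (u + i)) =
  (-1) ^+ (s + z + u) * p (- (s + z + u + i + w)%:R) /
    (ff X12 (u + (i + w)) * fa u * fa s * fa z * ff X1 s * ff X2 z * ff X3 (i + w) * fa (i +
      w)) *
  (qb (i + w) i * (p (w%:R * (X3 - (i + w)%:R + 1) - i%:R * (X12 - (u + (i + w))%:R + 1)) *
    rf (X3 - (i + w)%:R + 1) i * rf (X12 - (u + (i + w))%:R + 1) w)).
Proof.
move=> hX1 hX2 hX3 X12 hX12.
rewrite /sing_coef /desc_coef /qbinom !addKn.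
have -> : (u + (i + w) - (u + i) = w)%N by lia.
have EX := ff_split X12 (u + i) w; rewrite -addnA in EX.
have EY := ff_split X3 w i; rewrite (addnC w) in EY.
have := ff_neq0 (u + (i + w)) hX12; have := ff_neq0 (i + w) hX3.
rewrite EX EY !mulf_eq0 !negb_or => /andP[y1 y2] /andP[x1 x2].
have Ep : p ((z + i)%:R * ((z + i)%:R - 1) - (z + i)%:R * X2) *
   p (z%:R * (X2 - z%:R) - s%:R) * p (u%:R * i%:R - i%:R * (X1 - 2 * s%:R)) *
   p (w%:R * (X3 - w%:R) - (u + i)%:R) =
   p (- (s + z + u + i + w)%:R) *
   p (w%:R * (X3 - (i + w)%:R + 1) - i%:R * (X12 - (u + (i + w))%:R + 1)).
  by rewrite -!qexpD; congr qexp; rewrite /X12; ring.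
have Es : (-1) ^+ (z + i) * ((-1) ^+ s * (-1) ^+ (u + i)) = (-1) ^+ (s + z + u) :> F.
  rewrite !exprD; have : (-1) ^+ i * (-1) ^+ i = 1 :> F by rewrite -expr2 sqrr_sign.
  move: ((-1) ^+ i) ((-1) ^+ s) ((-1) ^+ u) ((-1) ^+ z) => a b c d aa.
  transitivity (a * a * (b * c * d)); first ring.
  by rewrite aa mul1r; ring.
have := fa_neq0 p u; have := fa_neq0 p s; have := fa_neq0 p z; have := fa_neq0 p i.
have := fa_neq0 p w; have := fa_neq0 p (u + i); have := fa_neq0 p (i + w).
have := ff_neq0 s hX1; have := ff_neq0 z hX2.
move: Ep Es; rewrite -/X12.
move: (rf _ w) (rf _ i) (ff X12 _) (ff X3 w) (ff X1 s) (ff X2 z) (fa u) (fa s) (fa z) (fa i)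
  (fa w) (fa (u + i)) (fa (i + w)) x1 x2 y1 y2.
move: (p _) (p _) (p _) (p _) (p _) (p _) => p1 p2 p3 p4 p5 p6.
move: ((-1) ^+ _) ((-1) ^+ _) ((-1) ^+ _) ((-1) ^+ _) => s1 s2 s3 s4.
move=> r1 r2 f1 f2 f3 f4 a1 a2 a3 a4 a5 a6 a7 ? ? ? ? Ep Es *.
transitivity (s4 * (s3 * s2) * (p6 * p5 * p4 * p3) /
  (a2 * a3 * f3 * f4 * (a1 * a4) * (a5 * f1 * f2))).
  by field; repeat (apply/andP; split).
by rewrite Es Ep; field; repeat (apply/andP; split).
Qed.

Section Fixed.
Variables (X1 X2 X3 : V) (N : nat).
Hypotheses (hX1 : nz X1) (hX2 : nz X2) (hX3 : nz X3).
Let L : V := X1 + X2 + X3 - N%:R - N%:R + 2.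

(** At level N the outer factor of [W12] is a coefficient of its singular vector. For fixed z, the
    sum over m is then a q-Vandermonde sum of length k - z. *)
Lemma sing_form_W12 J k : (J <= N)%N -> (k <= N)%N -> nz (X1 + X2 - 2 * J%:R) ->
  Phi X2 k (W12 p X1 X2 X3 N J (N - k)) =
  (-1) ^+ (N - k) * p (- N%:R) / ff (X1 + X2 - 2 * J%:R) (N - J) *
  \sum_(z < J.+1) (-1) ^+ z * rf (L + N%:R - J%:R - k%:R + z%:R) (k - z) *
    (fv (N + z) (J + k) * fv k z / (fa z * fa (J - z))) /
    (ff X1 (J - z) * ff X2 z * ff X3 (k - z)).
Proof.
move=> JN kN hX12.
pose g z m := if ((J - z <= N - k) && (z <= m))%N then
  sig J X1 X2 (J - z) * bk (X1 - 2 * (J - z)%:R) (N - k - (J - z)) (m - z) *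
  sig (N - J) (X1 + X2 - 2 * J%:R) X3 (N - k + m - J) else 0.
have Eg m : (m <= k)%N -> W12 p X1 X2 X3 N J (N - k) m (k - m) = \sum_(z < J.+1) g z m.
  move=> mk; rewrite /W12; have [h|h] := ltnP (N - k + m) J.
    rewrite cg_coef_small // mul0r big1 // => z _; rewrite /g ifF //; lia.
  rewrite (@cg_coef_level _ _ _ (N - J)); last by lia.
  rewrite /cg_coef big_mkcond (reindex_inj rev_ord_inj) mulr_suml; apply: eq_bigr => z _.
  have zJ : (z <= J)%N by rewrite -ltnS.
  by rewrite /g /= subSS (subKn zJ); case: ifP; rewrite ?mul0r.
rewrite /sing_form.
under eq_bigr => m _ do rewrite (Eg m (ltn_ord m)) mulr_sumr.
rewrite exchange_big mulr_sumr /=; apply: eq_bigr => z _.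
have zJ : (z <= J)%N by rewrite -ltnS.
move: (nat_of_ord z) zJ => {}z zJ.
(* The cut-offs J - z <= N - k and z <= k are those of the reciprocals of [N + z - J - k]! and
   [k - z]!. *)
have [h|h] := leqP (J - z) (N - k); last first.
  rewrite {1}/qfac_subV [(J + k <= N + z)%N]leqNgt ifF; last by lia.
  rewrite !(mul0r, mulr0) big1 // => m _; rewrite /g ifF ?mulr0 //; lia.
have [zk|zk] := leqP z k; last first.
  rewrite {2}/qfac_subV leqNgt zk /= !(mul0r, mulr0) big1 // => m _.
  rewrite /g ifF ?mulr0 //; have := ltn_ord m; lia.
pose G m := (-1) ^+ m * p (m%:R * (m%:R - 1) - m%:R * X2) *
  (sig J X1 X2 (J - z) * bk (X1 - 2 * (J - z)%:R) (N - k - (J - z)) (m - z) *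
  sig (N - J) (X1 + X2 - 2 * J%:R) X3 (N - k + m - J)).
transitivity (\sum_(m < k.+1 | (z <= m)%N) G m).
  rewrite [RHS]big_mkcond /=; apply: eq_bigr => m _.
  by rewrite /g h /=; case: (z <= m)%N; rewrite ?mulr0.
rewrite (@sum_shift _ k z G zk).
pose s := (J - z)%N; pose u := (N - k - s)%N; pose K := (k - z)%N.
have eJ : J = (s + z)%N by rewrite /s; lia.
have eN : (N - J = u + K)%N by rewrite /u /K /s; lia.
have eN' : (N = s + z + u + K)%N by rewrite /u /K /s; lia.
have ek : (k = z + K)%N by rewrite /K; lia.
have -> : L + N%:R - J%:R - k%:R + z%:R =
   (X1 + X2 - 2 * J%:R - (u + K)%:R + 1) + (X3 - K%:R + 1).
  rewrite /L eN' ek eJ; ring.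
rewrite -q_vandermonde -/s -/K !(mulr_sumr, mulr_suml); apply: eq_bigr => i _.
have iK : (i <= K)%N by rewrite -ltnS.
move: (nat_of_ord i) iK => {}i iK.
pose w := (K - i)%N; have eK : K = (i + w)%N by rewrite /w; lia.
have -> : (K - i = w)%N by [].
rewrite /G addKn -/s -/u.
have -> : (N - k + (z + i) - J = u + i)%N by rewrite /u /s; lia.
have T := @sing_form_term X1 X2 X3 s z u i w hX1 hX2 hX3; rewrite -eK -eJ in T.
rewrite eN (T hX12).
rewrite !qfac_subVE; try lia.
have -> : (N + z - (J + k) = u)%N by rewrite /u /s; lia.
have -> : (N - k = s + u)%N by rewrite /u /s; lia.
have -> : (J + u + i + w = N)%N by lia.
have -> : (-1) ^+ (J + u) = (-1) ^+ (s + u) * (-1) ^+ z :> F by rewrite -exprD; congr (_ ^+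
  _); lia.
rewrite -/K.
have := ff_neq0 (u + K) hX12; have := ff_neq0 K hX3; have := ff_neq0 s hX1; have := ff_neq0 z
  hX2.
have := fa_neq0 p u; have := fa_neq0 p s; have := fa_neq0 p z; have := fa_neq0 p K.
move: (rf _ i) (rf _ w) (ff _ (u + K)) (ff X3 K) (ff X1 s) (ff X2 z) (fa u) (fa s) (fa z) (fa
  K).
move: ((-1) ^+ _) ((-1) ^+ _) (p _) (p _) (qb _ _) => *.
by field; repeat (apply/andP; split).
Qed.

(** The sum in the theorem for Xi = 2 li, J = l1 + l2 - l12, k = l2 + l3 - l23; L is 2 l123 + 2. *)
Definition sears_sum J k : F :=
  \sum_(z < J.+1) (-1) ^+ z * rf L (N - z) *
    (ff (X1 - N%:R + k%:R) z * ff (X3 - N%:R + J%:R) z * ff (X2 - k%:R) (J - z)) *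
    (fv (N + z) (J + k) * fv k z / (fa z * fa (J - z))).

(* The first two factors are Delta(l2, l3, l23)^2 and Delta(l1, l23, l123)^2. *)
Definition recoupling_coef J k : F :=
  (fa k * ff X2 k * ff X3 k / rf (X2 + X3 - 2 * k%:R + 2) k) *
  (fa (N - k) * ff X1 (N - k) * ff (X2 + X3 - 2 * k%:R) (N - k) / rf L (N - k)) /
  (ff (X2 + X3 - 2 * k%:R) (N - k) * ff X3 k * ff (X1 + X2 - 2 * J%:R) (N - J) * ff X1 J * ff
    X2 J) *
  sears_sum J k.

Hypotheses (hX12 : nz (X1 + X2)) (hX23 : nz (X2 + X3)) (hX123 : nz (X1 + X2 + X3)).

Lemma nz12 J : nz (X1 + X2 - 2 * J%:R).
Proof. by have := nonintegral_shift (2 * J) hX12; rewrite natrM. Qed.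

Lemma nz23 k : nz (X2 + X3 - 2 * k%:R).
Proof. by have := nonintegral_shift (2 * k) hX23; rewrite natrM. Qed.

Lemma rf23_neq0 k : rf (X2 + X3 - 2 * k%:R + 2) k != 0.
Proof.
apply: (qrise_nonintegral hX23) => j jk; exists (2 * k - 2 - j)%N.
by rewrite !natrB; [ring | lia | lia].
Qed.

Lemma rfL_neq0 n : (n <= N)%N -> rf L n != 0.
Proof.
move=> nN; apply: (qrise_nonintegral hX123) => j jk; exists (2 * N - 2 - j)%N.
by rewrite /L !natrB; [ring | lia | lia].
Qed.

Lemma rfLJ_neq0 J : (J <= N)%N -> rf (L + N%:R - J%:R) J != 0.
Proof.
move=> JN; apply: (qrise_nonintegral hX123) => j jk; exists (N + J - 2 - j)%N.
by rewrite /L !natrB; [ring | lia | lia].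
Qed.

(** Writing 1 / ff X1 (J - z) as rf (X1 - J + 1) z / ff X1 J, and similarly for X2 and X3, gives the
    left-hand sum of [q_sears]. *)
Lemma sing_form_W12_sears J k : (J <= N)%N -> (k <= N)%N ->
  Phi X2 k (W12 p X1 X2 X3 N J (N - k)) =
  (-1) ^+ (N - k) * p (- N%:R) / ff (X1 + X2 - 2 * J%:R) (N - J) *
  (sears_sum J k / (rf L (N - k) * ff X1 J * ff X2 J * ff X3 k)).
Proof.
move=> JN kN; rewrite sing_form_W12 //; last exact: nz12.
congr (_ * _).
have := q_sears (x1 := X1) (x2 := X2) (x3 := X3) JN kN (rfLJ_neq0 JN).
rewrite -/L -/(sears_sum J k) => <-.
have r0 : rf L (N - k) != 0 by apply: rfL_neq0; exact: leq_subr.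
rewrite -(mulrA (_ * ff X1 J)) -(mulrA _ (ff X1 J)) -mulf_div divff // mul1r mulr_suml.
apply: eq_bigr => z _; have zJ : (z <= J)%N by rewrite -ltnS.
have [zk|zk] := leqP z k; last first.
  by rewrite /qfac_subV [(z <= k)%N]leqNgt zk /= !(mulr0, mul0r).
have E1 := ff_split X1 (J - z) z; rewrite (subnK zJ) in E1.
have E2 := ff_split X2 z (J - z); rewrite (subnKC zJ) in E2.
have E3 := ff_split X3 (k - z) z; rewrite (subnK zk) in E3.
have := ff_neq0 J hX1; have := ff_neq0 J hX2; have := ff_neq0 k hX3.
rewrite E1 E2 E3 !mulf_eq0 !negb_or => /andP[? ?] /andP[? ?] /andP[? ?].
have := fa_neq0 p z; have := fa_neq0 p (J - z).
move=> *; field; repeat (apply/andP; split); assumption.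
Qed.

Lemma f_stable_lin f g (c : F) f' : f_stable p X1 X2 N f -> f_stable p X1 X2 N g ->
  (forall m1 m2 m3, f' m1 m2 m3 = f m1 m2 m3 + c * g m1 m2 m3) -> f_stable p X1 X2 N f'.
Proof.
move=> Hf Hg E m1 m2 m3 h; rewrite E Hf // Hg //.
case: m1 m2 m3 {h} => [|m1] [|m2] [|m3] /=; rewrite ?E; ring.
Qed.

Lemma e_action3_lin f g (c : F) f' :
  (forall m1 m2 m3, f' m1 m2 m3 = f m1 m2 m3 + c * g m1 m2 m3) ->
  forall m1 m2 m3, e_action3 p X1 X2 X3 f' m1 m2 m3 =
    e_action3 p X1 X2 X3 f m1 m2 m3 + c * e_action3 p X1 X2 X3 g m1 m2 m3.
Proof. by move=> E m1 m2 m3; rewrite /e_action3 /e_action !E; ring. Qed.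

(** On this slice both factors of [W23] are coefficients of singular vectors, and the outer one is
    constant, so [sing_form_sing] evaluates the pairing. *)
Lemma recoupling_coefP J k : (J <= N)%N -> (k <= N)%N ->
  recoupling_coef J k * Phi X2 k (W23 p X1 X2 X3 N k (N - k)) =
  Phi X2 k (W12 p X1 X2 X3 N J (N - k)).
Proof.
move=> JN kN; rewrite sing_form_W12_sears //.
have -> : Phi X2 k (W23 p X1 X2 X3 N k (N - k)) =
  sig (N - k) X1 (X2 + X3 - 2 * k%:R) (N - k) *
  (p (- k%:R) * rf (X2 + X3 - 2 * k%:R + 2) k / (fa k * ff X2 k * ff X3 k)).
  rewrite -sing_form_sing // mulr_sumr; apply: eq_bigr => m _.
  have mk : (m <= k)%N by rewrite -ltnS.
  by rewrite /W23 cg_coef_level ?subnKC // subnn cg_coef_level ?addn0 //; ring.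
rewrite /sing_coef subnn fa0 ff0 !mulr1 mul0r sub0r.
have -> : p (- N%:R) = p (- (N - k)%:R) * p (- k%:R).
  by rewrite -qexpD natrB //; congr qexp; ring.
rewrite /recoupling_coef.
have := ff_neq0 J hX1; have := ff_neq0 J hX2; have := ff_neq0 k hX3; have := ff_neq0 k hX2.
have := ff_neq0 (N - k) hX1; have := ff_neq0 (N - k) (nz23 k); have := ff_neq0 (N - J) (nz12 J).
have := rfL_neq0 (leq_subr k N); have := rf23_neq0 k; have := fa_neq0 p k; have := fa_neq0 p
  (N - k).
move: (rf L _) (rf _ _) (fa k) (fa (N - k)) (ff X1 (N - k)) (ff X3 k) (ff X2 k) (ff X1 J) (ff
  X2 J)
  (ff _ (N - k)) (ff _ (N - J)) (sears_sum J k) ((-1) ^+ _) (p _) (p _) => *.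
by field; repeat (apply/andP; split).
Qed.

Lemma W12_expand J : (J <= N)%N -> forall m1 m2 m3, (N <= m1 + m2 + m3)%N ->
  W12 p X1 X2 X3 N J m1 m2 m3 =
  \sum_(k < N.+1) recoupling_coef J k * W23 p X1 X2 X3 N k m1 m2 m3.
Proof.
move=> JN m1 m2 m3 hm; apply/eqP; rewrite -subr_eq0; apply/eqP.
(* Subtracting only the first n terms lets F-stability and singularity pass from one summand to the
   next. *)
pose f n m1 m2 m3 := W12 p X1 X2 X3 N J m1 m2 m3 -
  \sum_(k < n) recoupling_coef J k * W23 p X1 X2 X3 N k m1 m2 m3.
have f0 a b c : f 0%N a b c = W12 p X1 X2 X3 N J a b c + 0 * W12 p X1 X2 X3 N J a b c.
  by rewrite /f big_ord0; ring.
have fS n a b c : f n.+1 a b c = f n a b c + (- recoupling_coef J n) * W23 p X1 X2 X3 N n a b c.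
  by rewrite /f big_ord_recr /=; ring.
have fl n : (n <= N.+1)%N -> f_stable p X1 X2 N (f n).
  have W12l := W12_f_stable p X1 X2 X3 JN.
  elim: n => [|n IH] h; first exact: (f_stable_lin W12l W12l f0).
  by apply: (f_stable_lin (IH (ltnW h)) _ (fS n)); exact: W23_f_stable.
have fe n a b c : (n <= N.+1)%N -> (a + b + c).+1 = N -> e_action3 p X1 X2 X3 (f n) a b c = 0.
  move=> + h; elim: n => [|n IH] hn.
    by rewrite (e_action3_lin f0) (W12_singular hX1 hX2 hX3 JN (nz12 J) h) mulr0 addr0.
  rewrite (e_action3_lin (fS n)) IH ?(ltnW hn) //.
  by rewrite (W23_singular hX1 hX2 hX3 _ (nz23 n) h) // mulr0 addr0.
apply: (f_stable_eq0 (fl N.+1 (leqnn _)) _ hm); apply: (singular_eq0 hX2 hX3).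
- by move=> a b c; exact: fe.
- exact: rf23_neq0.
move=> k kN.
have -> : Phi X2 k (f N.+1 (N - k)%N) = Phi X2 k (W12 p X1 X2 X3 N J (N - k)) -
   \sum_(j < N.+1) recoupling_coef J j * Phi X2 k (W23 p X1 X2 X3 N j (N - k)).
  rewrite /sing_form /f; under eq_bigr => m _ do rewrite mulrBr mulr_sumr.
  rewrite sumrB; congr (_ - _); rewrite exchange_big; apply: eq_bigr => j _ /=.
  by rewrite mulr_sumr; apply: eq_bigr => m _; ring.
rewrite (bigD1 (Ordinal (kN : (k < N.+1)%N))) //= big1 ?addr0.
  by rewrite recoupling_coefP // subrr.
move=> j jk; have {}jk : (j != k :> nat) by [].
have [h|h] := ltnP k j.
  rewrite /sing_form big1 ?mulr0 // => m _; rewrite /W23 cg_coef_small ?mul0r ?mulr0 //.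
  by rewrite subnKC // -ltnS.
have {}h : (j < k)%N by lia.
transitivity (recoupling_coef J j * (Q (N - j) X1 (X2 + X3 - 2 * j%:R) (N - k) (k - j) * Phi
  X2 k (Q j X2 X3))).
  congr (_ * _); rewrite /sing_form mulr_sumr; apply: eq_bigr => m _.
  rewrite /W23 subnKC; last by rewrite -ltnS.
  by ring.
by rewrite sing_form_cg // !mulr0.
Qed.

(** At (N + n - k, k, 0) the terms with j > k vanish, so the system is triangular, with nonzero
    coefficients of singular vectors on the diagonal. Any single level suffices, as the expansion is
    given for one weight a. *)
Lemma W23_free (d : nat -> F) n :
  (forall m1 m2 m3, (m1 + m2 + m3 = N + n)%N ->
     \sum_(k < N.+1) d k * W23 p X1 X2 X3 N k m1 m2 m3 = 0) ->
  forall k, (k <= N)%N -> d k = 0.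
Proof.
move=> H k; have [m] := ubnP k; elim: m k => // m IH k km kN.
have := H (N + n - k)%N k 0%N ltac:(lia).
rewrite (bigD1 (Ordinal (kN : (k < N.+1)%N))) //= big1 ?addr0.
  rewrite /W23 addn0 subnn !cg_coef_col0 //; last by lia.
  move/eqP; rewrite mulf_eq0 => /orP[/eqP //|]; apply: contraTeq => _.
  by apply: mulf_neq0; apply: sing_coef_neq0 => //; exact: nz23.
move=> j jk; have {}jk : (j != k :> nat) by [].
have [h|h] := ltnP k j; first by rewrite /W23 cg_coef_small ?addn0 // mul0r mulr0.
by rewrite IH ?mul0r //; lia.
Qed.

End Fixed.
End Expansion.

(** * The sum of the 3j-symbol as a coordinate of F^n u *)

Lemma sum_ord_swap (G : nmodType) a b (P : pred nat) (f : nat -> G) :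
  \sum_(i < a.+1 | (i <= b)%N && P i) f i = \sum_(i < b.+1 | (i <= a)%N && P i) f i.
Proof.
have W n m : (n.+1 <= m)%N -> forall Q : pred nat,
    \sum_(i < n.+1 | Q i) f i = \sum_(i < m | Q i && (i <= n)%N) f i.
  by move=> nm Q; rewrite (big_ord_widen_cond _ Q f nm).
have h1 : (a < (a + b).+1)%N by lia.
have h2 : (b < (a + b).+1)%N by lia.
rewrite (W _ _ h1 (fun i => (i <= b)%N && P i)) (W _ _ h2 (fun i => (i <= a)%N && P i)).
by apply: eq_bigl => i; case: (i <= a)%N; case: (i <= b)%N; case: (P i).
Qed.

Section ThreeJ.
Variables (V : comNzRingType) (F : fieldType) (p : qexponential V F).
Local Notation ff := (qfall p).
Local Notation rf := (qrise p).
Local Notation fa := (qfac p).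
Local Notation Q := (cg_coef p).
Local Notation nz := (nonintegral p).
Local Notation fv := (qfac_subV p).

(* With A = mu + a, this is the sum in the 3j-symbol, reindexed by s = m1 - z. *)
Lemma cg_coefE (X Y : V) J m1 m2 : nz X -> nz Y -> (J <= m1 + m2)%N ->
  let n := (m1 + m2 - J)%N in
  let A := X + Y - 2 * J%:R - n%:R in
  (-1) ^+ m1 * p (m2%:R * (Y - m2%:R) - n%:R * A - m1%:R) *
  \sum_(z < n.+1) (-1) ^+ z * p (z%:R * (A + 1)) *
    (rf (X - m1%:R + 1) z * rf (Y - m2%:R + 1) (n - z)) / fa z / fa (n - z) *
    fv m1 z * fv m2 (n - z) =
  Q J X Y m1 m2 * ff X m1 * ff Y m2 / fa n.
Proof.
move=> hX hY hJ n A; pose T z := (-1) ^+ z * p (z%:R * (A + 1)) *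
    (rf (X - m1%:R + 1) z * rf (Y - m2%:R + 1) (n - z)) / fa z / fa (n - z) *
    fv m1 z * fv m2 (n - z).
rewrite -/(T _); transitivity ((-1) ^+ m1 * p (m2%:R * (Y - m2%:R) - n%:R * A - m1%:R) *
   \sum_(z < n.+1 | (z <= m1)%N && (n - z <= m2)%N) T z).
  congr (_ * _); rewrite [RHS]big_mkcond /=; apply: eq_bigr => z _; rewrite -/(T z).
  case: ifP => // /negbT; rewrite negb_and -!ltnNge /T => /orP[]h.
    by rewrite {1}/qfac_subV leqNgt h /= mulr0 mul0r.
  by rewrite {2}/qfac_subV leqNgt h /= mulr0.
rewrite (sum_ord_swap n m1 (fun z => n - z <= m2)%N T) (reindex_inj rev_ord_inj) /=.
transitivity ((-1) ^+ m1 * p (m2%:R * (Y - m2%:R) - n%:R * A - m1%:R) *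
   \sum_(s < m1.+1 | (s <= J)%N && (J - s <= m2)%N) T (m1 - s)%N).
  congr (_ * _); apply: eq_big => [s|s _]; rewrite subSS // /n.
  have := ltn_ord s; lia.
rewrite (sum_ord_swap m1 J (fun s => J - s <= m2)%N (fun s => T (m1 - s)%N)).
rewrite /cg_coef !mulr_suml mulr_sumr; apply: eq_bigr => s /andP[sm1 sm2].
have sJ : (s <= J)%N by rewrite -ltnS.
move: (nat_of_ord s) sJ sm1 sm2 => {}s sJ sm1 sm2.
pose z := (m1 - s)%N; pose t := (J - s)%N; pose w := (m2 - t)%N.
have e1 : m1 = (s + z)%N by rewrite /z; lia.
have eJ : J = (s + t)%N by rewrite /t; lia.
have e2 : m2 = (t + w)%N by rewrite /w /t; lia.
have en : n = (z + w)%N by rewrite /n /z /w /t; lia.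
rewrite /T -/z en addKn.
rewrite !qfac_subVE; [|rewrite /w; lia|rewrite /z; lia].
have -> : (m1 - z = s)%N by rewrite /z; lia.
have -> : (m2 - w = t)%N by rewrite /w; lia.
rewrite /sing_coef /desc_coef -/t -/w.
have EX := ff_split p X s z; rewrite -e1 in EX.
have EY := ff_split p Y t w; rewrite -e2 in EY.
have := ff_neq0 m1 hX; have := ff_neq0 m2 hY.
rewrite EX EY !mulf_eq0 !negb_or => /andP[? ?] /andP[? ?].
have Es : (-1) ^+ m1 * (-1) ^+ z = (-1) ^+ s :> F.
  by rewrite e1 exprD -mulrA -expr2 sqrr_sign mulr1.
have Ep : p (m2%:R * (Y - m2%:R) - (z + w)%:R * A - m1%:R) * p (z%:R * (A + 1)) =
  p (t%:R * (Y - t%:R) - s%:R) * p (z%:R * w%:R - w%:R * (X - 2 * s%:R)).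
  by rewrite -!qexpD; congr qexp; rewrite /A en eJ e1 e2; ring.
have := fa_neq0 p z; have := fa_neq0 p w; have := fa_neq0 p s; have := fa_neq0 p t.
have := fa_neq0 p (z + w).
rewrite -Es; move: Ep.
move: (p _) (p _) (p _) (p _) ((-1) ^+ _) ((-1) ^+ _) => p1 p2 p3 p4 s1 s2 Ep *.
transitivity (s1 * s2 * (p4 * p3) * rf (X - m1%:R + 1) z * rf (Y - m2%:R + 1) w / (fa z * fa w
  * fa s * fa t)).
  by field; repeat (apply/andP; split).
by rewrite Ep; field; repeat (apply/andP; split).
Qed.

End ThreeJ.

(** * The complex exponential and the phases *)

Section ComplexExponential.
Variable R : realType.
Implicit Types (x y h : R[i]) (m n : nat).

Lemma expC0 : expC (0 : R[i]) = 1.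
Proof.
rewrite /expC raddf0 raddf0 expR0 cos0 sin0 mul1r.
by [].
Qed.

Lemma expCD : {morph @expC R : x y / x + y >-> x * y}.
Proof.
move=> [a b] [c d]; rewrite /expC /= expRD cosD sinD.
apply/eqP; rewrite eq_complex; simpc => /=.
by apply/andP; split; apply/eqP; ring.
Qed.

Lemma qpow0 h : qpow h 0 = 1.
Proof. by rewrite /qpow mulr0 mul0r expC0. Qed.

Lemma qpowD h : {morph qpow h : x y / x + y >-> x * y}.
Proof. by move=> x y; rewrite /qpow mulrDr mulrDl expCD. Qed.

Lemma expN1D : {morph @expN1 R : x y / x + y >-> x * y}.
Proof. by move=> x y; rewrite /expN1 mulrDr expCD. Qed.

Lemma expN1_0 : expN1 (0 : R[i]) = 1.
Proof. by rewrite /expN1 mulr0 expC0. Qed.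

Lemma expN1_nat n : expN1 (n%:R : R[i]) = (-1) ^+ n.
Proof.
have e1 : expN1 (1 : R[i]) = -1.
  rewrite /expN1 mulr1 /expC; simpc => /=.
  rewrite /= ?mul0r ?mul1r ?subr0 ?sub0r ?oppr0 expR0 cospi sinpi.
  by apply/eqP; rewrite eq_complex /=; apply/andP; split; apply/eqP; ring.
elim: n => [|n IH]; first by rewrite expN1_0.
by rewrite -addn1 natrD expN1D IH e1 exprD.
Qed.

Lemma expN1_neq0 x : expN1 x != 0.
Proof.
apply/negP => /eqP h; have := expN1D x (- x).
by rewrite subrr expN1_0 h mul0r => /eqP; rewrite oner_eq0.
Qed.

End ComplexExponential.

(** * Natural numbers among the complex numbers *)

Section IntegralWeights.
Variable R : realType.

Lemma isnatP (x : R[i]) : isnat x -> exists n : nat, x = n%:R.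
Proof. by move=> /eqP ->; exists (natC x). Qed.

Lemma isnatB m n : isnat (m%:R - n%:R : R[i]) = (n <= m)%N.
Proof.
have [h|h] := leqP n m; first by rewrite -natrB // isnat_nat.
apply/negP => /isnatP[k] /eqP; rewrite subr_eq -natrD eqr_nat => /eqP e.
by move: h; rewrite e; lia.
Qed.

Lemma natCB m n : (n <= m)%N -> natC (m%:R - n%:R : R[i]) = (m - n)%N.
Proof. by move=> h; rewrite -natrB // natCK. Qed.

End IntegralWeights.

(** * 3j-symbols in the basis F^m v *)

Section ThreeJSymbols.
Variables (R : realType) (h : R[i]).
Hypothesis hq : forall n, qnumber (qpow h) n.+1%:R != 0.
Let q : qexponential R[i] R[i] := QExponential (@qpowD R h) (qpow0 h) hq.
Local Notation ff := (qfall q).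
Local Notation rf := (qrise q).
Local Notation fa := (qfac q).
Local Notation Q := (cg_coef q).
Local Notation nz := (nonintegral q).
Local Notation fv := (qfac_subV q).

Lemma qfactV_natB m n : qfactV h (m%:R - n%:R) = fv m n.
Proof.
rewrite /qfactV /qfac_subV isnatB; case: leqP => // nm.
by rewrite natCB.
Qed.

Lemma prod_qnum1 x n : \prod_(1 <= j < n.+1) qnum h (x + j%:R) = rf (x + 1) n.
Proof.
rewrite big_add1 big_mkord /qrise; apply: eq_bigr => j _.
by rewrite -addrA -natr1 (addrC _ 1).
Qed.

(** A change of basis: F^m v = ff (2 mu) m e^mu_(mu - m), so each factor of the tensor product
    contributes an [ff] above and the source M_mu one below. *)
Lemma q3jE D (mu1 mu2 mu a1 a2 a : R[i]) J m1 m2 :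
  mu = mu1 + mu2 - J%:R -> a1 = mu1 - m1%:R -> a2 = mu2 - m2%:R -> a = a1 + a2 ->
  nz (2 * mu1) -> nz (2 * mu2) -> nz (2 * mu) ->
  q3j h D mu1 mu2 mu a1 a2 a =
  expN1 (J%:R / 2) * D mu1 mu2 mu * Q J (2 * mu1) (2 * mu2) m1 m2 *
  ff (2 * mu1) m1 * ff (2 * mu2) m2 / ff (2 * mu) (m1 + m2 - J).
Proof.
move=> emu ea1 ea2 ea h1 h2 h3.
have em1 : mu1 - a1 = m1%:R by rewrite ea1; ring.
have em2 : mu2 - a2 = m2%:R by rewrite ea2; ring.
have eJ : mu1 + mu2 - mu = J%:R by rewrite emu; ring.
have em : mu - a = (m1 + m2)%:R - J%:R by rewrite ea ea1 ea2 emu; ring.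
rewrite /q3j em1 em2 eJ em !isnat_nat isnatB -ea eqxx /= andbT.
(* Below level J, a is not a weight of M_mu, so the symbol is 0 by definition, and so is Q. *)
case: (leqP J (m1 + m2)) => hJ; last by rewrite cg_coef_small // !(mulr0, mul0r).
rewrite natCB //; set n := (m1 + m2 - J)%N.
have -> : J%:R / 2 + mu1 - a1 = J%:R / 2 + m1%:R :> R[i] by rewrite -em1; ring.
rewrite expN1D expN1_nat prod_qnum1.
have en : n%:R = m1%:R + m2%:R - J%:R :> R[i] by rewrite natrB // natrD.
have ern : rf (mu + a + 1) n = ff (2 * mu) n.
  rewrite (ffE q); congr rf; rewrite en ea ea1 ea2 emu; ring.
rewrite ern.
have := cg_coefE h1 h2 hJ; cbv zeta; rewrite -/n.
have -> : 2 * mu1 + 2 * mu2 - 2 * J%:R - n%:R = mu + a by rewrite en ea ea1 ea2 emu; ring.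
have -> : m2%:R * (2 * mu2 - m2%:R) - n%:R * (mu + a) - m1%:R =
  mu2 ^+ 2 - a2 ^+ 2 - (mu ^+ 2 - a ^+ 2) - m1%:R.
  by rewrite en ea ea1 ea2 emu; ring.
set S := \sum_(z < n.+1) _; set S' := \sum_(z < n.+1) _ => E.
have -> : S' = S.
  apply: eq_bigr => z _; have zn : (z <= n)%N by rewrite -ltnS.
  rewrite !prod_qnum1 !qfactV_natB.
  have -> : mu1 + a1 = 2 * mu1 - m1%:R by rewrite ea1; ring.
  by have -> : mu2 + a2 = 2 * mu2 - m2%:R by rewrite ea2; ring.
have fn := fa_neq0 q n.
have E' : Q J (2 * mu1) (2 * mu2) m1 m2 * ff (2 * mu1) m1 * ff (2 * mu2) m2 =
   (-1) ^+ m1 * q (mu2 ^+ 2 - a2 ^+ 2 - (mu ^+ 2 - a ^+ 2) - m1%:R) * S * fa n.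
  by rewrite E divfK.
transitivity (expN1 (J%:R / 2) * D mu1 mu2 mu *
   (Q J (2 * mu1) (2 * mu2) m1 m2 * ff (2 * mu1) m1 * ff (2 * mu2) m2) / ff (2 * mu) n); last
     by rewrite !mulrA.
rewrite E'.
rewrite -[qpow h _]/(q _) -[qfact h n]/(fa n).
move: ((-1) ^+ _) (q _) (expN1 _) (D _ _ _) (fa n) (ff _ n) => *.
ring.
Qed.

End ThreeJSymbols.

(** * Coordinates in the triple tensor product *)

Section WeightSums.
Variables (R : realType) (l1 l2 l3 : R[i]).
Implicit Types (c : R[i] -> R[i] -> R[i] -> R[i]) (a : R[i]).

Lemma wt_inj (mu : R[i]) : injective (wt mu).
Proof.
move=> m n /(congr1 val) /= /(congr1 (fun x => mu - x)).
by rewrite !subKr => /eqP; rewrite eqr_nat => /eqP.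
Qed.

Lemma coeff_weight_sum c a d m1 m2 m3 : l1 + l2 + l3 - a = d%:R -> (m1 + m2 + m3 = d)%N ->
  coeff (wt l1 m1, wt l2 m2, wt l3 m3) (weight_sum l1 l2 l3 c a) =
  c (l1 - m1%:R) (l2 - m2%:R) (l3 - m3%:R).
Proof.
move=> ea em; rewrite /weight_sum ea natCK raddf_sum /=.
have h1 : (m1 < d.+1)%N by lia.
have h2 : (m2 < d.+1)%N by lia.
have h3 : (m3 < d.+1)%N by lia.
rewrite (bigD1 (Ordinal h1, Ordinal h2, Ordinal h3)) /=; last by rewrite em.
rewrite coeffU eqxx mulr1 big1 ?addr0 // => -[[i1 i2] i3] /andP[_ ne] /=.
rewrite coeffU; case: eqP => [e|]; last by rewrite mulr0.
have /wt_inj e1 := congr1 (fun w => w.1.1) e; have /wt_inj e2 := congr1 (fun w => w.1.2) e.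
have /wt_inj e3 := congr1 (fun w => w.2) e.
by case/negP: ne; apply/eqP; congr (_, _, _); apply: val_inj.
Qed.

Lemma weight_sum_lin n c (x : nat -> R[i]) (g : nat -> R[i] -> R[i] -> R[i] -> R[i]) a d :
  l1 + l2 + l3 - a = d%:R ->
  (forall m1 m2 m3, (m1 + m2 + m3 = d)%N ->
    c (l1 - m1%:R) (l2 - m2%:R) (l3 - m3%:R) =
    \sum_(k < n) x k * g k (l1 - m1%:R) (l2 - m2%:R) (l3 - m3%:R)) ->
  weight_sum l1 l2 l3 c a = \sum_(k < n) x k *: weight_sum l1 l2 l3 (g k) a.
Proof.
move=> ea E; apply/eqP/freeg_eqP => w; rewrite !raddf_sum ea natCK /=.
under [RHS]eq_bigr => k _ do rewrite coeffZ /weight_sum ea natCK raddf_sum mulr_sumr.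
rewrite exchange_big; apply: eq_bigr => m /eqP hm.
rewrite coeffU E // mulr_suml; apply: eq_bigr => k _.
by rewrite /= coeffU /= mulrA.
Qed.

End WeightSums.

(** * The 6j-symbols *)

Section Main.
Variables (R : realType) (h : R[i]) (D : R[i] -> R[i] -> R[i] -> R[i]).
Variables (l1 l2 l3 : R[i]) (J J' : nat).
Hypotheses (hD : is_Delta h D) (hgen : generic h l1 l2 l3) (hhalf : no_half_nat l1 l2 l3).

Lemma qnumberS_generic n : qnumber (qpow h) n.+1%:R != 0.
Proof.
have := @hgen n.+1 0 0 0; rewrite /= !mulr0 !mul0r !addr0 => H.
by apply: H; rewrite pnatr_eq0.
Qed.

Let q : qexponential R[i] R[i] := QExponential (@qpowD R h) (qpow0 h) qnumberS_generic.
Local Notation ff := (qfall q).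
Local Notation rf := (qrise q).
Local Notation fa := (qfac q).
Local Notation nz := (nonintegral q).

(** [generic] concerns nonzero arguments only; [no_half_nat] ensures that twice the partial sum,
    minus n, is nonzero. The booleans encode the subset I. *)
Lemma nz_partial_sum (b1 b2 b3 : bool) : [|| b1, b2 | b3] ->
  nz (b1%:R * (2 * l1) + b2%:R * (2 * l2) + b3%:R * (2 * l3)).
Proof.
move=> hb n; have := @hgen (- n%:Z) b1%:Z b2%:Z b3%:Z.
pose I := [set i : 'I_3 | nth false [:: b1; b2; b3] i]%SET.
have I0 : I != finset.set0.
  apply/finset.set0Pn; case/or3P: hb => hb.
  - by exists (inord 0); rewrite inE inordK.
  - by exists (inord 1); rewrite inE inordK.
  - by exists (inord 2); rewrite inE inordK.
have := hhalf I0 n; rewrite big_mkcond !big_ord_recl big_ord0 /= !inE /= => hn H.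
have E (b : bool) (x : R[i]) : (if b then x else 0) = b%:R * x by case: b; rewrite ?mul1r
  ?mul0r.
rewrite !E addr0 addrA in hn.
move: H; rewrite mulrNz -!pmulrn -/(qn q _).
set x := - n%:R + _ + _ + _; have -> : x = 2 * (b1%:R * l1 + b2%:R * l2 + b3%:R * l3) - n%:R.
  by rewrite /x; ring.
set y := b1%:R * l1 + _ + _ in hn *.
have -> : b1%:R * (2 * l1) + b2%:R * (2 * l2) + b3%:R * (2 * l3) = 2 * y by rewrite /y; ring.
apply; apply: contraNneq hn => /eqP; rewrite subr_eq0 => /eqP <-.
by rewrite mulrAC divff ?mul1r // pnatr_eq0.
Qed.

Lemma nz1 : nz (2 * l1).
Proof. by have := @nz_partial_sum true false false isT; rewrite !mul0r mul1r !addr0. Qed.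

Lemma nz2 : nz (2 * l2).
Proof. by have := @nz_partial_sum false true false isT; rewrite !mul0r mul1r addr0 add0r. Qed.

Lemma nz3 : nz (2 * l3).
Proof. by have := @nz_partial_sum false false true isT; rewrite !mul0r mul1r !add0r. Qed.

Lemma nz_12 : nz (2 * l1 + 2 * l2).
Proof. by have := @nz_partial_sum true true false isT; rewrite !mul0r !mul1r addr0. Qed.

Lemma nz_23 : nz (2 * l2 + 2 * l3).
Proof. by have := @nz_partial_sum false true true isT; rewrite !mul0r !mul1r add0r. Qed.

Lemma nz_123 : nz (2 * l1 + 2 * l2 + 2 * l3).
Proof. by have := @nz_partial_sum true true true isT; rewrite !mul1r. Qed.

Let N := (J + J')%N.
Let l12 : R[i] := l1 + l2 - J%:R.
Let l123 : R[i] := l1 + l2 + l3 - N%:R.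
Let l23 k : R[i] := l2 + l3 - k%:R.
Let JN : (J <= N)%N. Proof. exact: leq_addr. Qed.

(* The scalars relating W12 and W23 to vec12 and vec23, apart from the Deltas:
   they depend only on the basis vector, not on the coupling. *)
Definition coupling_scale m1 m2 m3 n : R[i] :=
  expN1 (N%:R / 2) * (ff (2 * l1) m1 * ff (2 * l2) m2 * ff (2 * l3) m3 / ff (2 * l123) n).

Lemma nz_l123 : nz (2 * l123).
Proof.
have -> : 2 * l123 = 2 * l1 + 2 * l2 + 2 * l3 - (2 * N)%:R by rewrite /l123; ring.
exact: (nonintegral_shift _ nz_123).
Qed.

Lemma double_l12 : 2 * l12 = 2 * l1 + 2 * l2 - 2 * J%:R.
Proof. by rewrite /l12; ring. Qed.

Lemma double_l23 k : 2 * l23 k = 2 * l2 + 2 * l3 - 2 * k%:R.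
Proof. by rewrite /l23; ring. Qed.

Lemma nz_l12 : nz (2 * l12).
Proof. by rewrite double_l12; exact: (nz12 nz_12). Qed.

Lemma nz_l23 k : nz (2 * l23 k).
Proof. by rewrite double_l23; exact: (nz23 nz_23). Qed.

Lemma coupling_scale_neq0 m1 m2 m3 n : coupling_scale m1 m2 m3 n != 0.
Proof.
apply: mulf_neq0; first exact: expN1_neq0.
rewrite mulf_neq0 ?invr_neq0 ?ff_neq0 //; last exact: nz_l123.
by rewrite !mulf_neq0 ?ff_neq0 //; [exact: nz1|exact: nz2|exact: nz3].
Qed.

Lemma sum_weights m1 m2 m3 n a : l123 - a = n%:R -> (m1 + m2 + m3 = N + n)%N ->
  a = (l1 - m1%:R) + (l2 - m2%:R) + (l3 - m3%:R).
Proof.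
move=> ea em; have -> : a = l123 - n%:R by rewrite -ea subKr.
have -> : n%:R = m1%:R + m2%:R + m3%:R - N%:R :> R[i] by rewrite -!natrD em natrD; ring.
by rewrite /l123; ring.
Qed.

(** The factor [ff (2 * l12) (m1 + m2 - J)] occurs above in one symbol and below in the other and
    cancels, and the phases multiply to (-1)^(N / 2). This is why the scale does not depend on the
    intermediate weight. *)
Lemma vec12_coeff m1 m2 m3 n a : l123 - a = n%:R -> (m1 + m2 + m3 = N + n)%N ->
  let a1 := l1 - m1%:R in let a2 := l2 - m2%:R in let a3 := l3 - m3%:R in
  q3j h D l12 l3 l123 (a1 + a2) a3 a * q3j h D l1 l2 l12 a1 a2 (a1 + a2) =
  coupling_scale m1 m2 m3 n * (D l12 l3 l123 * D l1 l2 l12 *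
    W12 q (2 * l1) (2 * l2) (2 * l3) N J m1 m2 m3).
Proof.
move=> ea em a1 a2 a3; have ea' : a = a1 + a2 + a3 by exact: sum_weights ea em.
rewrite /W12 addKn -double_l12.
rewrite (@q3jE _ _ qnumberS_generic D l1 l2 l12 a1 a2 (a1 + a2) J m1 m2) //;
  [|exact: nz1|exact: nz2|exact: nz_l12].
have [hJ|hJ] := ltnP (m1 + m2) J.
  by rewrite !(@cg_coef_small _ _ q J) // !(mulr0, mul0r).
rewrite (@q3jE _ _ qnumberS_generic D l12 l3 l123 (a1 + a2) a3 a J' (m1 + m2 - J) m3) //;
  [| by rewrite /l123 /l12 /N natrD; ring | by rewrite /a1 /a2 /l12 natrB // natrD; ring
   | exact: nz_l12 | exact: nz3 | exact: nz_l123].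
have -> : (m1 + m2 - J + m3 - J' = n)%N by rewrite /N in em; lia.
rewrite -/q /coupling_scale.
have -> : N%:R / 2 = J%:R / 2 + J'%:R / 2 :> R[i] by rewrite /N natrD mulrDl.
rewrite expN1D; have := ff_neq0 (m1 + m2 - J) nz_l12.
move: (ff (2 * l123) n)^-1 => x; move: (ff (2 * l12) _) => y.
move: (cg_coef _ _ _ _ _ _) (cg_coef _ _ _ _ _ _) (expN1 _) (expN1 _) (D _ _ _) (D _ _ _).
move: (ff _ _) (ff _ _) (ff _ _) => *; field; assumption.
Qed.

Lemma vec23_coeff k m1 m2 m3 n a : (k <= N)%N -> l123 - a = n%:R -> (m1 + m2 + m3 = N + n)%N ->
  let a1 := l1 - m1%:R in let a2 := l2 - m2%:R in let a3 := l3 - m3%:R in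
  q3j h D l1 (l23 k) l123 a1 (a2 + a3) a * q3j h D l2 l3 (l23 k) a2 a3 (a2 + a3) =
  coupling_scale m1 m2 m3 n * (D l1 (l23 k) l123 * D l2 l3 (l23 k) *
    W23 q (2 * l1) (2 * l2) (2 * l3) N k m1 m2 m3).
Proof.
move=> kN ea em a1 a2 a3; have ea' : a = a1 + (a2 + a3) by rewrite addrA; exact: sum_weights
  ea em.
rewrite /W23 -double_l23.
rewrite (@q3jE _ _ qnumberS_generic D l2 l3 (l23 k) a2 a3 (a2 + a3) k m2 m3) //;
  [|exact: nz2|exact: nz3|exact: nz_l23].
have [hJ|hJ] := ltnP (m2 + m3) k.
  by rewrite !(@cg_coef_small _ _ q k) // !(mulr0, mul0r).
rewrite (@q3jE _ _ qnumberS_generic D l1 (l23 k) l123 a1 (a2 + a3) a (N - k) m1 (m2 + m3 - k))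
  //;
  [| by rewrite /l123 /l23 natrB //; ring | by rewrite /a3 /a2 /l23 natrB // natrD; ring
   | exact: nz1 | exact: nz_l23 | exact: nz_l123].
have -> : (m1 + (m2 + m3 - k) - (N - k) = n)%N by lia.
rewrite -/q /coupling_scale.
have -> : N%:R / 2 = k%:R / 2 + (N - k)%:R / 2 :> R[i] by rewrite -mulrDl -natrD subnKC.
rewrite expN1D; have := ff_neq0 (m2 + m3 - k) (nz_l23 k).
move: (ff (2 * l123) n)^-1 => x; move: (ff (2 * l23 k) _) => y.
move: (cg_coef _ _ _ _ _ _) (cg_coef _ _ _ _ _ _) (expN1 _) (expN1 _) (D _ _ _) (D _ _ _).
move: (ff _ _) (ff _ _) (ff _ _) => *; field; assumption.
Qed.

Lemma DeltaE mu1 mu2 mu j : mu = mu1 + mu2 - j%:R ->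
  D mu1 mu2 mu ^+ 2 = fa j * ff (2 * mu1) j * ff (2 * mu2) j / rf (2 * mu + 2) j.
Proof.
move=> emu; have e : mu1 + mu2 - mu = j%:R by rewrite emu; ring.
have := @hD mu1 mu2 mu; rewrite e isnat_nat natCK => -> //.
by rewrite prodf_div big_split /= !mulrA.
Qed.

Lemma q6j_formulaE k : (k <= N)%N ->
  q6j_formula h D l1 l2 l3 l12 l123 (l23 k) =
  D l1 (l23 k) l123 / ff (2 * l23 k) (N - k) * (D l2 l3 (l23 k) / ff (2 * l3) k) *
  (D l12 l3 l123 / ff (2 * l12) J') * (D l1 l2 l12 / ff (2 * l1) J) * (ff (2 * l2) J)^-1 *
  sears_sum q (2 * l1) (2 * l2) (2 * l3) N J k.
Proof.
move=> kN; rewrite /q6j_formula.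
have -> : l1 + l2 - l12 = J%:R by rewrite /l12; ring.
have -> : l1 + l23 k - l123 = (N - k)%:R by rewrite /l23 /l123 natrB //; ring.
have -> : l2 + l3 - l23 k = k%:R by rewrite /l23; ring.
have -> : l12 + l3 - l123 = J'%:R by rewrite /l12 /l123 /N natrD; ring.
have -> : l1 + l2 + l3 - l123 = N%:R by rewrite /l123; ring.
rewrite !natCK; congr (_ * _); apply: eq_bigr => z _.
have zJ : (z <= J)%N by rewrite -ltnS.
rewrite !natCB ?(leq_trans zJ) // !(qfactV_natB qnumberS_generic).
have -> : l12 + l23 k - l2 - l123 + z%:R = (N + z)%:R - (J + k)%:R.
  by rewrite /l12 /l23 /l123 !natrD; ring.
rewrite (qfactV_natB qnumberS_generic) -/q (qfac_subVE q zJ) -[qfact h z]/(fa z).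
have -> : l123 + l1 - l23 k = 2 * l1 - N%:R + k%:R by rewrite /l123 /l23; ring.
have -> : l123 - l12 + l3 = 2 * l3 - N%:R + J%:R by rewrite /l123 /l12; ring.
have -> : l2 + l23 k - l3 = 2 * l2 - k%:R by rewrite /l23; ring.
have -> : 2 * l123 + 2 = 2 * l1 + 2 * l2 + 2 * l3 - N%:R - N%:R + 2 by rewrite /l123; ring.
congr (_ * _); rewrite invfM; ring.
Qed.

Lemma DeltaE_neq0 mu1 mu2 mu j : mu = mu1 + mu2 - j%:R ->
  nz (2 * mu1) -> nz (2 * mu2) -> rf (2 * mu + 2) j != 0 -> D mu1 mu2 mu != 0.
Proof.
move=> emu h1 h2 h3; rewrite -sqrf_eq0 (DeltaE emu).
by rewrite mulf_neq0 ?invr_neq0 // !mulf_neq0 ?fa_neq0 ?ff_neq0.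
Qed.

(** [recoupling_coef] contains the squares of the two Deltas that involve l23, and [vec23] carries
    one power of each; the other power stays in the 6j-symbol, whatever the choice of roots. *)
Lemma q6j_formula_coef k : (k <= N)%N ->
  q6j_formula h D l1 l2 l3 l12 l123 (l23 k) * (D l1 (l23 k) l123 * D l2 l3 (l23 k)) =
  D l12 l3 l123 * D l1 l2 l12 * recoupling_coef q (2 * l1) (2 * l2) (2 * l3) N J k.
Proof.
move=> kN; rewrite q6j_formulaE // /recoupling_coef.
have e1 : l123 = l1 + l23 k - (N - k)%:R by rewrite /l123 /l23 natrB //; ring.
have e2 : l23 k = l2 + l3 - k%:R by [].
have := DeltaE e1; have := DeltaE e2; rewrite -double_l12 -double_l23.
have -> : 2 * l23 k + 2 = 2 * l2 + 2 * l3 - 2 * k%:R + 2 by rewrite double_l23.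
have -> : 2 * l123 + 2 = 2 * l1 + 2 * l2 + 2 * l3 - N%:R - N%:R + 2 by rewrite /l123; ring.
move=> <- <-; rewrite addKn.
move: (ff (2 * l23 k) _) (ff _ k) (ff _ J') (ff _ J) (ff _ J) (sears_sum _ _ _ _ _ _ _) (D _ _
  _) (D _ _ _) (D _ _ _) (D _ _ _) => *.
rewrite !invfM; ring.
Qed.

Lemma D_l23_neq0 k : (k <= N)%N -> D l1 (l23 k) l123 * D l2 l3 (l23 k) != 0.
Proof.
move=> kN; apply: mulf_neq0.
  apply: (@DeltaE_neq0 _ _ _ (N - k)); [|exact: nz1|exact: nz_l23|].
    by rewrite /l123 /l23 natrB //; ring.
  have -> : 2 * l123 + 2 = 2 * l1 + 2 * l2 + 2 * l3 - N%:R - N%:R + 2 by rewrite /l123; ring.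
  exact: (rfL_neq0 nz_123 (leq_subr k N)).
apply: (@DeltaE_neq0 _ _ _ k); [by []|exact: nz2|exact: nz3|].
by rewrite double_l23; exact: (rf23_neq0 nz_23).
Qed.

(** Existence is [W12_expand] read coordinatewise, uniqueness is [W23_free] after division by the
    nonzero scale and Deltas. *)
Lemma q6j_expansionP a n c : l123 - a = n%:R ->
  q6j_expansion h D l1 l2 l3 l12 l123 a c <->
  forall k, (k <= N)%N -> c (l23 k) = q6j_formula h D l1 l2 l3 l12 l123 (l23 k).
Proof.
move=> ea; rewrite /q6j_expansion.
have eN : l1 + l2 + l3 - l123 = N%:R by rewrite /l123; ring.
have ead : l1 + l2 + l3 - a = (N + n)%:R by rewrite natrD -ea -eN; ring.
rewrite eN natCK.
have W12E m1 m2 m3 : (m1 + m2 + m3 = N + n)%N -> _ :=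
  fun em => W12_expand nz1 nz2 nz3 nz_12 nz_23 nz_123 JN (leq_trans (leq_addr n N) (eq_leq
    (esym em))).
split=> [E|E]; last first.
  apply: (@weight_sum_lin _ _ _ _ N.+1 _ (fun k => c (l23 k))
    (fun k a1 a2 a3 => q3j h D l1 (l23 k) l123 a1 (a2 + a3) a *
                       q3j h D l2 l3 (l23 k) a2 a3 (a2 + a3)) _ _ ead) => m1 m2 m3 em.
  rewrite (vec12_coeff ea em) (W12E _ _ _ em).
    rewrite !mulr_sumr; apply: eq_bigr => k _; have kN : (k <= N)%N by rewrite -ltnS.
    rewrite (vec23_coeff kN ea em) E // (mulrA (D l12 l3 l123 * _)) -q6j_formula_coef //.
    by rewrite [RHS]mulrCA; congr (_ * _); rewrite !mulrA.
pose d k := c (l23 k) * (D l1 (l23 k) l123 * D l2 l3 (l23 k)) -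
  D l12 l3 l123 * D l1 l2 l12 * recoupling_coef q (2 * l1) (2 * l2) (2 * l3) N J k.
suff d0 k : (k <= N)%N -> d k = 0.
  move=> k kN; apply: (mulIf (D_l23_neq0 kN)); rewrite q6j_formula_coef //.
  by apply/eqP; rewrite -subr_eq0; apply/eqP; exact: d0.
apply: (@W23_free _ _ q (2 * l1) (2 * l2) (2 * l3) N nz1 nz2 nz3 nz_23 d n) => m1 m2 m3 em.
apply: (mulfI (coupling_scale_neq0 m1 m2 m3 n)); rewrite mulr0.
have := congr1 (coeff (wt l1 m1, wt l2 m2, wt l3 m3)) E.
rewrite /vec12 (coeff_weight_sum _ ead em) (vec12_coeff ea em) raddf_sum /=.
rewrite (W12E _ _ _ em).
  move=> /esym/eqP; rewrite -subr_eq0 => /eqP E'; rewrite -[RHS]E'.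
  rewrite !mulr_sumr -sumrB; apply: eq_bigr => j _; have jN : (j <= N)%N by rewrite -ltnS.
  rewrite coeffZ /vec23 (coeff_weight_sum _ ead em) (vec23_coeff jN ea em) /d.
  rewrite mulrBl mulrBr [X in _ = X - _]mulrCA; congr (_ * _ - _ * _); by rewrite !mulrA.
Qed.

End Main.

Theorem theorem6p1 (R : realType) (h : R[i])
    (D : R[i] -> R[i] -> R[i] -> R[i]) (l1 l2 l3 l12 l123 : R[i]) :
  is_Delta h D ->
  generic h l1 l2 l3 ->
  no_half_nat l1 l2 l3 ->
  isnat (l1 + l2 - l12) ->
  isnat (l12 + l3 - l123) ->
  forall a : R[i], isnat (l123 - a) ->
  forall c : R[i] -> R[i],
    q6j_expansion h D l1 l2 l3 l12 l123 a c <->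
    (forall l23 : R[i],
       isnat (l2 + l3 - l23) -> isnat (l1 + l23 - l123) ->
       c l23 = q6j_formula h D l1 l2 l3 l12 l123 l23).
Proof.
move=> hD hgen hhalf /isnatP[J eJ] /isnatP[J' eJ'] a /isnatP[n en] c.
have e12 : l12 = l1 + l2 - J%:R by rewrite -eJ subKr.
have e123 : l123 = l1 + l2 + l3 - (J + J')%:R.
  by rewrite natrD -eJ -eJ'; ring.
move: eJ eJ' en; rewrite e12 e123 => _ _ en.
rewrite (q6j_expansionP hD hgen hhalf c en).
split=> H.
  move=> l23 /isnatP[k ek] h1.
  have e23 : l23 = l2 + l3 - k%:R by rewrite -ek subKr.
  rewrite e23; apply: H; move: h1.
  (* The second integrality condition on l23 amounts to k <= J + J'. *)
  have -> : l1 + l23 - (l1 + l2 + l3 - (J + J')%:R) = (J + J')%:R - k%:R by rewrite e23; ring.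
  by rewrite isnatB.
move=> k kN; apply: H.
  have -> : l2 + l3 - (l2 + l3 - k%:R) = k%:R by ring.
  exact: isnat_nat.
have -> : l1 + (l2 + l3 - k%:R) - (l1 + l2 + l3 - (J + J')%:R) = (J + J')%:R - k%:R by ring.
by rewrite isnatB.
Qed.
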